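(* Let $X\subset\mathbf{P}^2$ be a smooth projective plane curve of degree $a\ge3$ over $\mathbf{F}_q$, let $m\ge0$ be an integer, let $L$ be a line of $\mathbf{P}^2$ and let $G_m$ be the pullback of $mL$ by the inclusion $X\hookrightarrow\mathbf{P}^2$. Let $P_1,\dots,P_n$ be $n$ distinct rational points of $X$ avoiding the support of $G_m$ and $D=P_1+\cdots+P_n$. Consider the code $C_{\Omega}(D,G_m)=C_L(D,G_m)^{\bot}$. Let $$\delta=\begin{cases} m+2 & \text{if } 0\le m\le a-2,\\ 2m+2 & \text{if } m=a-1,\\ 3m & \text{if } m\ge a,\end{cases}\qquad \delta_G=a(m+3-a).$$ Then $\delta>\delta_G$ if and only if $\delta_G\le 0$ (or equivalently, if and only if $m\le a-3$). In other words, $\delta$ is a lower bound for the minimum distance of $C_L(D,G_m)^{\bot}$, and it improves the Goppa designed distance $\delta_G$ as a lower bound for this minimum distance whenever $\delta_G\le0$.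
   Context: $C_L(D,G)$ denotes the image of $L(G)\to\mathbf{F}_q^n$, $f\mapsto(f(P_1),\dots,f(P_n))$, where $L(G)$ is the Riemann–Roch space of $G$; $C^{\bot}$ is the orthogonal of $C\subset\mathbf{F}_q^n$ for the canonical inner product, and $C_{\Omega}(D,G)$ denotes the differential code, equal to $C_L(D,G)^{\bot}$. The Goppa designed distance is $\delta_G=\deg(G_m)-(2g_X-2)$ with $g_X=(a-1)(a-2)/2$, i.e. $\delta_G=a(m+3-a)$. The minimum distance is the smallest Hamming weight of a nonzero codeword ($+\infty$ for the zero code). *)

(* Defs.v *)
From HB Require Import structures.
From mathcomp Require Import all_boot all_order all_algebra.
From mathcomp Require Import boolp.
From mathcomp.multinomials Require Export mpoly.

Set Implicit Arguments.
Unset Strict Implicit.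
Unset Printing Implicit Defensive.

Import Order.TTheory GRing.Theory Num.Theory.
Local Open Scope ring_scope.

(* Points of P^2 over a field K are nonzero vectors of K^3 up to scaling. *)
Definition same_point (K : fieldType) (u v : 'rV[K]_3) : Prop :=
  exists c : K, c != 0 /\ u = c *: v.

Section PlaneCurve.

(* [K] is meant to be an algebraic closure of [k]; [F] is the equation of a
   plane curve X over [k]. *)
Variables (k : fieldType) (K : closedFieldType) (iota : {rmorphism k -> K}).
Variable F : {mpoly k[3]}.

Definition geval (A : {mpoly k[3]}) (P : 'rV[K]_3) : K :=
  (map_mpoly iota A).@[P 0].

Definition on_curve (P : 'rV[K]_3) : Prop := P != 0 /\ geval F P = 0.

Definition smooth_curve : Prop :=
  forall P, on_curve P -> exists i : 'I_3, geval (mderiv i F) P != 0.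

Definition curve_dvd (A : {mpoly k[3]}) : Prop := exists Q, A = Q * F.

(* Elements of the function field k(X): fractions A/B, coded by the pair (A, B),
   of forms of the same degree with B nonzero on X, modulo [rateq].  All
   operations below are on representatives. *)
Definition ratfun : Type := ({mpoly k[3]} * {mpoly k[3]})%type.

Definition is_ratfun (f : ratfun) : Prop :=
  exists d : nat,
    [/\ f.1 \is d.-homog, f.2 \is d.-homog & ~ curve_dvd f.2].

Definition rateq (f g : ratfun) : Prop := curve_dvd (f.1 * g.2 - g.1 * f.2).

Definition ratmul (f g : ratfun) : ratfun := (f.1 * g.1, f.2 * g.2).

(* For a negative exponent this is meaningful for f nonzero only. *)
Definition ratexp (f : ratfun) (e : int) : ratfun :=
  match e with
  | Posz n => (f.1 ^+ n, f.2 ^+ n)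
  | Negz n => (f.2 ^+ n.+1, f.1 ^+ n.+1)
  end.

(* The local ring O_{X,P} over k of the closed point of X below the geometric
   point P, its maximal ideal and its units. *)
Definition regular_at (P : 'rV[K]_3) (f : ratfun) : Prop :=
  exists g, [/\ is_ratfun g, rateq f g & geval g.2 P != 0].

Definition vanishes_at (P : 'rV[K]_3) (f : ratfun) : Prop :=
  exists g,
    [/\ is_ratfun g, rateq f g, geval g.2 P != 0 & geval g.1 P = 0].

Definition unit_at (P : 'rV[K]_3) (f : ratfun) : Prop :=
  exists g,
    [/\ is_ratfun g, rateq f g, geval g.2 P != 0 & geval g.1 P != 0].

Definition uniformizer_at (P : 'rV[K]_3) (t : ratfun) : Prop :=
  [/\ is_ratfun t, ~ curve_dvd t.1, vanishes_at P t &
      forall g, is_ratfun g -> vanishes_at P g ->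
        exists r, [/\ is_ratfun r, regular_at P r & rateq g (ratmul t r)]].

(* v_P(f) = e *)
Definition val_eq (P : 'rV[K]_3) (f : ratfun) (e : int) : Prop :=
  exists t u, [/\ uniformizer_at P t, is_ratfun u, unit_at P u &
                  rateq f (ratmul (ratexp t e) u)].

(* v_P(f) >= e, where v_P(0) = +oo *)
Definition val_ge (P : 'rV[K]_3) (f : ratfun) (e : int) : Prop :=
  exists t r, [/\ uniformizer_at P t, is_ratfun r, regular_at P r &
                  rateq f (ratmul (ratexp t e) r)].

(* A divisor on X is given by its coefficients at the geometric points of X;
   its values at vectors that are not on X are irrelevant.  The pullback to X
   of m times the line l = 0 has local equation (l/X_i)^m where X_i <> 0. *)
Definition is_pullback (m : nat) (l : {mpoly k[3]}) (G : 'rV[K]_3 -> int) :=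
  forall P, on_curve P -> forall i : 'I_3, P 0 i != 0 ->
    val_eq P (l ^+ m, 'X_i ^+ m) (G P).

Definition in_support (G : 'rV[K]_3 -> int) (P : 'rV[K]_3) : Prop :=
  on_curve P /\ G P != 0.

Definition riemann_roch (G : 'rV[K]_3 -> int) (f : ratfun) : Prop :=
  is_ratfun f /\ forall P, on_curve P -> val_ge P f (- G P).

(* f(P) = c, at a k-rational point P *)
Definition has_value (f : ratfun) (P : 'rV[k]_3) (c : k) : Prop :=
  exists g, [/\ is_ratfun g, rateq f g, g.2.@[P 0] != 0 &
                c = g.1.@[P 0] / g.2.@[P 0]].

End PlaneCurve.

Definition functional_code (k : finFieldType) (K : closedFieldType)
    (iota : {rmorphism k -> K}) (F : {mpoly k[3]}) (n : nat)
    (P : 'I_n -> 'rV[k]_3) (G : 'rV[K]_3 -> int) : {set 'rV[k]_n} :=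
  [set c : 'rV[k]_n | `[< exists f, riemann_roch iota F G f /\
                         forall i, has_value F f (P i) (c 0 i) >] ].

Section Codes.

Variables (k : finFieldType) (n : nat).

Definition dual_code (C : {set 'rV[k]_n}) : {set 'rV[k]_n} :=
  [set c : 'rV[k]_n | [forall x : 'rV[k]_n in C, \sum_(i < n) c 0 i * x 0 i == 0]].

Definition hamming_weight (c : 'rV[k]_n) : nat := #|[set i | c 0 i != 0]|.

(* [None] stands for +oo *)
Definition min_distance (C : {set 'rV[k]_n}) : option nat :=
  if [pick c in C :\ 0] is Some c0
  then Some (hamming_weight [arg min_(c < c0 in C :\ 0) hamming_weight c])
  else None.

End Codes.

Definition le_distance (e : nat) (d : option nat) : bool :=
  if d is Some w then (e <= w)%N else true.

Definition delta (a m : nat) : nat :=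
  if (m <= a - 2)%N then m.+2
  else if m == (a - 1)%N then (2 * m + 2)%N
  else (3 * m)%N.

Definition delta_G (a m : nat) : int := a%:Z * (m%:Z + 3 - a%:Z).

(* Main.v *)
(** Proof idea. A nonzero word of the dual code is a linear relation between the
    values, at the points of its support, of all forms of degree m (divided by
    l^m); so its support fails to impose independent conditions on curves of
    degree m. Multiplying a relation by a curve of degree e gives a relation in
    degree m - e supported off that curve. Starting from the bound m + 2 on the
    number of points, this yields by induction: at most 2m + 1 points contain
    m + 2 points on a line, and fewer than 3m points contain m + 2 points on a
    line or 2m + 2 points on a conic. Since a smooth curve of degree a >= 3 is
    irreducible, Bezout allows at most a of the points on a line and 2a on a
    conic, which rules out weights below delta.

    The induction has one hard case: no three points on a line, no six on a
    conic, exactly 3m - 1 points. These then lie on an irreducible cubic E, and a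
    curve of degree m - 1 that is not a multiple of E passes through all but
    three of them but, by Bezout, not through all of them; the residual relation
    makes the three remaining points collinear.

    Everything takes place in an affine chart, with bivariate polynomials in
    K[s][z], where irreducibility is exploited through Gauss's lemma and
    resultants with respect to z. *)

Require Import Defs.
From mathcomp Require Import all_boot all_order all_algebra.
From mathcomp Require Import fingroup perm boolp.
From mathcomp Require Import zify ring.
Import Order.TTheory GRing.Theory.
Local Open Scope ring_scope.
Set Implicit Arguments.
Unset Strict Implicit.
Unset Printing Implicit Defensive.

(** * Total degree and leading forms of bivariate polynomials *)

Section TotalDegree.
Variable R : comNzRingType.
Implicit Types p q : {poly {poly R}}.

Definition tdeg_le (n : nat) p := forall i j, (n < i + j)%N -> p`_j`_i = 0.

Lemma tdeg_le0 n : tdeg_le n 0.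
Proof. by move=> i j _; rewrite !coef0. Qed.

Lemma tdeg_leW n m p : (n <= m)%N -> tdeg_le n p -> tdeg_le m p.
Proof. by move=> nm hp i j h; apply: hp; lia. Qed.

Lemma tdeg_leD n p q : tdeg_le n p -> tdeg_le n q -> tdeg_le n (p + q).
Proof. by move=> hp hq i j h; rewrite !coefD hp ?hq ?addr0. Qed.

Lemma tdeg_leN n p : tdeg_le n p -> tdeg_le n (- p).
Proof. by move=> hp i j h; rewrite !coefN hp ?oppr0. Qed.

Lemma tdeg_leM n m p q : tdeg_le n p -> tdeg_le m q -> tdeg_le (n + m) (p * q).
Proof.
move=> hp hq i j h; rewrite coefM coef_sum big1 // => b _.
rewrite coefM big1 // => a _.
case: (ltnP n (a + b)) => [/hp -> | le_n]; first by rewrite mul0r.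
by rewrite [q`_ _`_ _]hq ?mulr0 //; have := ltn_ord a; have := ltn_ord b; lia.
Qed.

Lemma tdeg_le_sum I (r : seq I) (P : pred I) (F : I -> {poly {poly R}}) n :
  (forall i, P i -> tdeg_le n (F i)) -> tdeg_le n (\sum_(i <- r | P i) F i).
Proof.
by move=> h; apply: big_ind; [exact: tdeg_le0 | exact: tdeg_leD | exact: h].
Qed.

Lemma tdeg_leX n m p : tdeg_le n p -> tdeg_le (n * m) (p ^+ m).
Proof.
move=> hp; elim: m => [|m ihm].
  rewrite muln0 expr0 => i j h; rewrite coef1.
  by case: j h => [|j] h /=; rewrite ?coef0 // coef1; case: i h.
by rewrite mulnS exprS; apply: tdeg_leM.
Qed.

Lemma tdeg_le_const (c : R) : tdeg_le 0 c%:P%:P.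
Proof.
move=> i j h; rewrite coefC; case: j h => [|j] h /=; rewrite ?coef0 //.
by rewrite coefC; case: i h.
Qed.

Lemma tdeg_le_s : tdeg_le 1 'X%:P.
Proof.
move=> i j h; rewrite coefC; case: j h => [|j] h /=; rewrite ?coef0 //.
by rewrite coefX; case: i h => [|[|i]].
Qed.

Lemma tdeg_le_z : tdeg_le 1 'X.
Proof.
move=> i j h; rewrite coefX; case: eqP => [jE|]; last by rewrite coef0.
by rewrite coef1; case: i h => //; rewrite jE.
Qed.

Lemma tdeg_leZ n (c : R) p : tdeg_le n p -> tdeg_le n (c%:P%:P * p).
Proof. by move=> hp; rewrite -[n]add0n; apply: tdeg_leM => //; apply: tdeg_le_const. Qed.

(* The leading form of [p] at total degree [n], with [s = 1]. *)
Definition top (n : nat) p : {poly R} := \poly_(j < n.+1) p`_j`_(n - j).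

Lemma coef_top n p j : tdeg_le n p -> (top n p)`_j = p`_j`_(n - j).
Proof.
move=> hp; rewrite coef_poly ltnS; case: leqP => // lt_nj.
by rewrite hp //; lia.
Qed.

(** In total degree [n + m] only products of terms that reach both degree bounds survive, so one
    index of the inner convolution remains. *)
Lemma topM n m p q : tdeg_le n p -> tdeg_le m q ->
  top (n + m) (p * q) = top n p * top m q.
Proof.
move=> hp hq; apply/polyP => j; rewrite coef_top; last exact: tdeg_leM.
rewrite !coefM coef_sum; apply: eq_bigr => b _.
rewrite !coef_top // coefM; have le_bj : (b <= j)%N by rewrite -ltnS.
have [lt_nb|le_bn] := ltnP n b.
  rewrite big1 => [|a _]; first by rewrite hp ?mul0r //; lia.
  by rewrite hp ?mul0r //; lia.
have [lt_m|le_m] := ltnP m (j - b).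
  rewrite big1 => [|a _]; first by rewrite [q`_ _`_ _]hq ?mulr0 //; lia.
  by rewrite [q`_ _`_ _]hq ?mulr0 //; lia.
have lt_a : (n - b < (n + m - j).+1)%N by lia.
rewrite (bigD1 (Ordinal lt_a)) //= big1 ?addr0 => [|a /eqP ne_a].
  by rewrite (_ : n + m - j - (n - b) = m - (j - b))%N //; lia.
have {}ne_a : (a : nat) <> (n - b)%N by move=> e; apply: ne_a; apply: val_inj.
case: (ltnP (n - b) a) => h; first by rewrite hp ?mul0r //; lia.
by rewrite [q`_ _`_ _]hq ?mulr0 //; have := ltn_ord a; lia.
Qed.

Lemma top_eq0 n p : tdeg_le n p -> top n p = 0 -> p != 0 ->
  (0 < n)%N /\ tdeg_le n.-1 p.
Proof.
move=> hp t0 p0.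
have h i j : (n <= i + j)%N -> p`_j`_i = 0.
  rewrite leq_eqVlt => /orP [/eqP e|/hp //].
  have := congr1 (fun u : {poly R} => u`_j) t0.
  by rewrite coef0 coef_top // e addnK.
case: n {hp t0} h => [|n] h; last by split.
case/negP: p0; apply/eqP/polyP => j; apply/polyP => i; rewrite !coef0; exact: h.
Qed.

Lemma tdeg_le_size p : exists n, tdeg_le n p.
Proof.
pose M := (\max_(j < size p) size (p`_j)%R)%N.
exists (size p + M)%N => i j h.
have [lt_j|/(nth_default 0) ->] := ltnP j (size p); last by rewrite coef0.
have le_j : (size (p`_j)%R <= M)%N by apply: (leq_bigmax (Ordinal lt_j)).
by apply: nth_default; apply: leq_trans le_j _; lia.
Qed.

Lemma exists_tdeg p : p != 0 -> exists n, tdeg_le n p /\ top n p != 0.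
Proof.
move=> p0; have [n] := tdeg_le_size p; elim: n => [|n ihn] hp.
  by exists 0%N; split=> //; apply/eqP => /(top_eq0 hp) /(_ p0) [].
have [t0|tn0] := eqVneq (top n.+1 p) 0; last by exists n.+1.
by have [_ /ihn] := top_eq0 hp t0 p0.
Qed.

Lemma tdeg_le_size_outer n p : tdeg_le n p -> (size p <= n.+1)%N.
Proof.
by move=> hp; apply/leq_sizeP => j lt_nj; apply/polyP => i; rewrite coef0 hp //; lia.
Qed.

Lemma size_coef_tdeg n p j : tdeg_le n p -> (size (p`_j)%R <= n.+1 - j)%N.
Proof. by move=> hp; apply/leq_sizeP => i lt; rewrite hp //; lia. Qed.

Lemma tdeg_le_const_form p : tdeg_le 0 p -> exists c : R, p = c%:P%:P.
Proof.
move=> hp; exists p`_0`_0; apply/polyP => -[|j]; apply/polyP => -[|i];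
  by rewrite ?(coefC, coef0) //= ?coefC ?coef0 // hp.
Qed.

End TotalDegree.

(* Evaluation at [(s, z)]: the inner variable is [s], the outer one is [z]. *)
Notation ev p s z := (p.[z%:P].[s]).

(** * Irreducible polynomials in K[s][z] *)

(** Leading forms multiply to a nonzero form in a domain, so the exact total degrees of the factors
    add up to that of the product. *)
Lemma tdeg_factor (R : idomainType) (g h : {poly {poly R}}) n :
  tdeg_le n (g * h) -> g * h != 0 ->
  exists d e, [/\ (d + e <= n)%N, tdeg_le d g, tdeg_le e h,
                  top d g != 0 & top e h != 0].
Proof.
move=> hn gh0; move: (gh0); rewrite mulf_eq0 negb_or => /andP [g0 h0].
have [d [hd td]] := exists_tdeg g0; have [e [he te]] := exists_tdeg h0.
exists d, e; split=> //; rewrite leqNgt; apply/negP => lt_n.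
have: top (d + e) (g * h) != 0 by rewrite topM // mulf_neq0.
case/eqP; apply/polyP => j; rewrite coef_poly coef0; case: ifP => // hj.
by rewrite hn //; lia.
Qed.

Section Closed.
Variable K : closedFieldType.
Implicit Types (f g h p q : {poly {poly K}}) (c : {poly K}).

Definition specialize (x : K) p : {poly K} := map_poly (horner_eval x) p.

Lemma specialize_eq0 x p : specialize x p = 0 ->
  exists p1, p = ('X - x%:P) *: p1.
Proof.
move=> px0; exists (\poly_(j < size p) (p`_j %/ ('X - x%:P))).
apply/polyP => j; rewrite coefZ coef_poly.
case: ltnP => [_|/(nth_default 0) ->]; last by rewrite mulr0.
rewrite mulrC divpK // dvdp_XsubCl rootE; apply/eqP.
by have := congr1 (fun u : {poly K} => u`_j) px0; rewrite coef_map coef0.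
Qed.

(** Induction along the splitting into linear factors; it lets denominators in [K[s]] be cleared one
    root at a time. *)
Lemma poly_ind_root (P : {poly K} -> Prop) :
  (forall x : K, x != 0 -> P x%:P) ->
  (forall x c, c != 0 -> P c -> P (('X - x%:P) * c)) ->
  forall c, c != 0 -> P c.
Proof.
move=> Pc PX c; have [n] := ubnP (size c); elim: n c => // n ihn c sz c0.
have [/eqP/size_poly1P [x x0 ->]|/closed_rootP [x]] := eqVneq (size c) 1%N.
  exact: Pc.
case/factor_theorem => c1 cE; rewrite cE mulrC.
have c10 : c1 != 0 by apply: contraNneq c0 => c10; rewrite cE c10 mul0r.
by apply: PX => //; apply: ihn => //; move: sz; rewrite cE size_Mmonic ?monicXsubC // size_XsubC addn2.
Qed.

Lemma scaleX_inj x p q : ('X - x%:P) *: p = ('X - x%:P) *: q -> p = q.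
Proof.
rewrite -!mul_polyC; apply: mulfI.
by rewrite polyC_eq0 polyXsubC_eq0.
Qed.

(** Gauss's lemma: specializing [s] at a root of [c] kills [g * h], hence one of the factors, from
    which the linear factor of [c] is then cancelled. The sizes record that degrees in [z] do not
    change. *)
Lemma Gauss_factor c : c != 0 -> forall f g h, c *: f = g * h ->
  exists g' h', [/\ f = g' * h', size g' = size g & size h' = size h].
Proof.
move: c; apply: poly_ind_root => [x x0|x c c0 ih] f g h e.
  exists ((x^-1)%:P *: g), h; split=> //.
    rewrite -scalerAl -e scalerA -polyCM mulVf // scale1r //.
  by rewrite size_scale // polyC_eq0 invr_eq0.
have := congr1 (specialize x) e; rewrite /specialize rmorphM /= map_polyZ /=.
rewrite {1}/horner_eval hornerM hornerXsubC subrr mul0r scale0r.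
move/esym/eqP; rewrite mulf_eq0 => /orP [/eqP|/eqP] /specialize_eq0 [u uE].
  move: e; rewrite uE -scalerA -scalerAl => /scaleX_inj /ih [g' [h' [? sg sh]]].
  exists g', h'; split=> //.
  by rewrite sg size_scale // polyXsubC_eq0.
move: e; rewrite uE -scalerA -scalerAr => /scaleX_inj /ih [g' [h' [? sg sh]]].
exists g', h'; split=> //.
by rewrite sh size_scale // polyXsubC_eq0.
Qed.

(** Same cancellation as in [Gauss_factor]; since no specialization of [f] vanishes, each linear
    factor of [c] must come out of [q]. *)
Lemma primitive_dvd f c : (forall x, specialize x f != 0) ->
  c != 0 -> forall p q, c *: p = q * f -> exists q', p = q' * f.
Proof.
move=> f_prim; move: c; apply: poly_ind_root => [x x0|x c c0 ih] p q e.
  exists ((x^-1)%:P *: q).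
  by rewrite -scalerAl -e scalerA -polyCM mulVf // scale1r.
have := congr1 (specialize x) e; rewrite /specialize rmorphM /= map_polyZ /=.
rewrite {1}/horner_eval hornerM hornerXsubC subrr mul0r scale0r.
move/esym/eqP; rewrite mulf_eq0 (negPf (f_prim x)) orbF.
move/eqP/specialize_eq0 => [u uE].
by move: e; rewrite uE -scalerA -scalerAl => /scaleX_inj /ih.
Qed.

(* Irreducibility in [K[s, z]], for polynomials that involve [z]. *)
Definition irr f := (1 < size f)%N /\
  forall g h, f = g * h ->
    (exists x : K, g = x%:P%:P) \/ (exists x : K, h = x%:P%:P).

Lemma irr_neq0 f : irr f -> f != 0.
Proof. by case=> sz _; rewrite -size_poly_gt0; apply: ltn_trans sz. Qed.

Lemma irr_primitive f : irr f -> forall x, specialize x f != 0.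
Proof.
move=> [sz irrf] x; apply/eqP => /specialize_eq0 [u].
rewrite -mul_polyC => fE; have [[y]|[y uE]] := irrf _ _ fE.
  by move/polyC_inj/(congr1 (fun v : {poly K} => size v));
    rewrite size_XsubC => e; have := size_polyC_leq1 y; rewrite -e.
by move: sz; rewrite fE uE -polyCM ltnNge size_polyC_leq1.
Qed.

(** The gcd is taken over [K(s)] and divides [f] only up to a factor of [K[s]]. Gauss's lemma turns
    this into a true factorization with the same degrees in [z]; irreducibility makes the cofactor
    free of [z], so [f] divides the gcd up to a factor, which primitivity removes. *)
Lemma irr_dvd f p : irr f -> ~~ coprimep f p -> exists q, p = q * f.
Proof.
move=> irrf; rewrite coprimep_def => gcd1.
have [sz irrf'] := irrf; have f0 := irr_neq0 irrf.
have /Pdiv.WeakIdomain.dvdpP [[c u] /= c0 uE] := dvdp_gcdl f p.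
have g0 : gcdp f p != 0 by rewrite gcdp_eq0 negb_and f0.
have u0 : u != 0.
  by apply: contraNneq f0 => u0; move/eqP: uE; rewrite u0 mul0r scale_poly_eq0 (negPf c0).
have [u' [g' [fE su sg]]] := Gauss_factor c0 uE.
have sgcd : (1 < size (gcdp f p))%N.
  by rewrite ltn_neqAle eq_sym gcd1 size_poly_gt0.
have su1 : size u = 1%N.
  have [[x xE]|[x xE]] := irrf' _ _ fE.
    have := size_polyC_leq1 (x%:P : {poly K}); rewrite -xE su.
    by rewrite -size_poly_gt0 in u0; case: (size u) u0 => [|[]].
  by move: sgcd; rewrite -sg xE ltnNge size_polyC_leq1.
have /size_poly1P [b b0 uE'] : size u == 1%N by apply/eqP.
have f_gcd : f %| gcdp f p.
  by apply/Pdiv.WeakIdomain.dvdpP; exists (b, c%:P) => //=;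
    rewrite mul_polyC uE uE' mul_polyC.
have /Pdiv.WeakIdomain.dvdpP [[b' w] /= b'0 wE] := dvdp_trans f_gcd (dvdp_gcdr f p).
exact: (primitive_dvd (irr_primitive irrf) b'0 wE).
Qed.

Lemma irr_prime f p q r : irr f -> p * q = r * f ->
  (exists u, p = u * f) \/ (exists u, q = u * f).
Proof.
move=> irrf e; have [cop|/(irr_dvd irrf)] := boolP (coprimep f p); last by left.
have : f %| p * q by rewrite e dvdp_mull.
rewrite Gauss_dvdpr // => /Pdiv.WeakIdomain.dvdpP [[b w] /= b0 wE].
by right; apply: (primitive_dvd (irr_primitive irrf) b0 wE).
Qed.

End Closed.

(** * Resultants and Bezout's bound *)

Lemma prod_coef_bound (R : comNzRingType) (I : Type) (r : seq I)
    (F : I -> {poly R}) (w : I -> nat) :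
  (forall i, (size (F i) <= (w i).+1)%N) ->
  (size (\prod_(i <- r) F i)%R <= (\sum_(i <- r) w i).+1)%N /\
  (\prod_(i <- r) F i)`_(\sum_(i <- r) w i) = \prod_(i <- r) (F i)`_(w i).
Proof.
move=> hF; elim: r => [|i r [ih1 ih2]].
  by rewrite !big_nil size_poly1 coef1.
rewrite !big_cons; set P := \prod_(j <- r) F j in ih1 ih2 *.
set W := (\sum_(j <- r) w j)%N in ih1 ih2 *; split.
  by have := hF i; have := size_polyMleq (F i) P; lia.
have lt_w : (w i < (w i + W).+1)%N by lia.
rewrite coefM (bigD1 (Ordinal lt_w)) //= addKn -ih2 big1 ?addr0 // => a /eqP ne.
have {}ne : (a : nat) <> w i by move=> e; apply: ne; apply: val_inj.
have [lt_a|le_a] := ltnP a (w i).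
  by rewrite [P`__]nth_default ?mulr0 //; apply: leq_trans ih1 _; have := ltn_ord a; lia.
by rewrite [(F i)`__]nth_default ?mul0r //; apply: leq_trans (hF i) _; lia.
Qed.

(** Each permutation contributes degree at most the sum of all [w i - s i], which is [D] whatever
    the permutation, so the coefficient of degree [D] is the determinant of the extreme
    coefficients. *)
Lemma det_coef_bound (R : comNzRingType) N (M : 'M[{poly R}]_N) (w : 'I_N -> nat) D :
  (forall i j, (size (M i j) <= (w i).+1 - j)%N) ->
  (\sum_(i < N) w i = D + \sum_(j < N) j)%N ->
  (size (\det M)%R <= D.+1)%N /\
  (\det M)`_D = \det (\matrix_(i, j) (M i j)`_(w i - j)).
Proof.
move=> hM hD.
have H (s : 'S_N) :
    (size (\prod_i M i (s i))%R <= D.+1)%N /\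
    (\prod_i M i (s i))`_D = \prod_i (M i (s i))`_(w i - s i).
  (* Subtraction is truncated here: if [w i < s i], the size bound forces the entry to be zero and
     both sides vanish. *)
  have [/existsP [i lt_i]|] := boolP [exists i, (w i < s i)%N].
    have Mi0 : M i (s i) = 0.
      by apply/eqP; rewrite -size_poly_leq0; apply: leq_trans (hM _ _) _; lia.
    have -> : \prod_i M i (s i) = 0 by rewrite (bigD1 i) //= Mi0 mul0r.
    by rewrite size_poly0 coef0 (bigD1 i) //= Mi0 coef0 mul0r.
  rewrite negb_exists => /forallP hs.
  have {}hs i : (s i <= w i)%N by have := hs i; rewrite -leqNgt.
  have hF i : (size (M i (s i)) <= (w i - s i).+1)%N.
    by apply: leq_trans (hM _ _) _; have := hs i; lia.
  have := prod_coef_bound (index_enum 'I_N) hF.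
  suff -> : (\sum_i (w i - s i) = D)%N by [].
  rewrite sumnB // hD [X in (_ + X)%N](reindex_inj (h := s)) /=; last exact: perm_inj.
  by rewrite addnK.
split.
  apply: leq_trans (size_sum _ _ _) _; apply/bigmax_leqP => s _.
  by rewrite size_Msign; have [] := H s.
rewrite coef_sum; apply: eq_bigr => s _.
have -> : (-1) ^+ s * \prod_i M i (s i) = ((-1) ^+ s : R) *: \prod_i M i (s i).
  by case: (odd_perm s); rewrite ?expr1 ?expr0 ?mulN1r ?mul1r ?scaleN1r ?scale1r.
rewrite coefZ; have [_ ->] := H s; congr (_ * _).
by apply: eq_bigr => i _; rewrite mxE.
Qed.

(** The degrees [a] and [b] are formal, so the matrix keeps its shape when it is filled with leading
    forms of smaller degree. *)
Definition sylvester (R : nzRingType) (a b : nat) (P Q : nat -> R) : 'M_(b + a) :=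
  \matrix_(i, j) match split i with
                 | inl k => P (j - k)%N *+ (k <= j)
                 | inr k => Q (j - k)%N *+ (k <= j) end.

Lemma resultantE (R : nzRingType) (p q : {poly R}) :
  resultant p q = \det (sylvester (size p).-1 (size q).-1 (nth 0 p) (nth 0 q)).
Proof.
by congr (\det _); apply/matrixP => i j; rewrite Sylvester_mxE mxE.
Qed.

(** This is the degree count behind Bezout: [D] is at most [d * e] when [a <= d] and [b <= e], with
    equality when [a = d] and [b = e]. *)
Lemma resultant_coef_bound (R : comNzRingType) (g h : {poly {poly R}}) d e a b D :
  tdeg_le d g -> tdeg_le e h -> (size g).-1 = a -> (size h).-1 = b ->
  (D = b * d + a * e - a * b)%N -> (a * b <= b * d + a * e)%N ->
  (size (resultant g h) <= D.+1)%N /\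
  (resultant g h)`_D = \det (sylvester a b (nth 0 (top d g)) (nth 0 (top e h))).
Proof.
move=> hg hh sa sb DE leD; rewrite resultantE sa sb.
(* Row [k] of the first block has at column [j] the coefficient of index [j - k], of degree at most
   [(d + k) - j] in [s]; likewise with [e] in the second block. *)
pose w (i : 'I_(b + a)) := (match split i with inl k => d + k | inr k => e + k end)%N.
case: (@det_coef_bound R _ (sylvester a b (nth 0 g) (nth 0 h)) w D).
- move=> i j; rewrite mxE /w; case: (split i) => k;
    (rewrite mulrb; case: (leqP k j) => le_kj; rewrite ?size_poly0 //);
    by first [apply: leq_trans (size_coef_tdeg _ hg) _; lia
             |apply: leq_trans (size_coef_tdeg _ hh) _; lia].
- rewrite !big_split_ord /= /w.
  have -> : (\sum_(i < b) match split (lshift a i) with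
      | inl k => d + k | inr k => e + k end = b * d + \sum_(i < b) i)%N.
    rewrite -[X in (X * d)%N]card_ord -sum_nat_const -big_split /=.
    apply: eq_bigr => i _; case: splitP => k /= ik; last by have := ltn_ord i; lia.
    by rewrite ik.
  have -> : (\sum_(i < a) match split (rshift b i) with
      | inl k => d + k | inr k => e + k end = a * e + \sum_(i < a) i)%N.
    rewrite -[X in (X * e)%N]card_ord -sum_nat_const -big_split /=.
    apply: eq_bigr => i _; case: splitP => k /= ik; first by have := ltn_ord k; lia.
    lia.
  have -> : (\sum_(i < a) (b + i) = a * b + \sum_(i < a) i)%N.
    by rewrite big_split /= sum_nat_const card_ord.
  rewrite DE; move: (\sum_(i < b) i)%N (\sum_(i < a) i)%N => u v; lia.
move=> sz ->; split=> //; congr (\det _); apply/matrixP => i j; rewrite !mxE /w.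
case: (split i) => k; rewrite !mulrb; case: leqP => lkj; rewrite ?coef0 //.
  by rewrite coef_top // subnBA // addnC.
by rewrite coef_top // subnBA // addnC.
Qed.

Section Intersection.
Variable K : closedFieldType.
Implicit Types (f g h p q : {poly {poly K}}) (c : {poly K}).

Lemma horner_specialize p s z : (specialize s p).[z] = ev p s z.
Proof.
rewrite -[ev p s z]/(horner_eval s p.[z%:P]) -horner_map /=.
by rewrite /horner_eval hornerC.
Qed.

Lemma common_root (p q : {poly K}) : (1 < size (gcdp p q))%N ->
  exists x, p.[x] = 0 /\ q.[x] = 0.
Proof.
move=> sz; have /closed_rootP [x] : size (gcdp p q) != 1%N by rewrite gtn_eqF.
by rewrite root_gcd => /andP [/eqP px /eqP qx]; exists x.
Qed.

Lemma lead_coef_tdeg g d : (0 < d)%N -> tdeg_le d g -> (size g).-1 = d ->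
  exists2 x : K, x != 0 & lead_coef g = x%:P.
Proof.
move=> d0 hg sg; have g0 : g != 0 by rewrite -size_poly_gt0; lia.
have /size1_polyC e : (size (lead_coef g) <= 1)%N.
  by rewrite /lead_coef sg; apply: leq_trans (size_coef_tdeg _ hg) _; lia.
by exists (lead_coef g)`_0 => //; rewrite -(polyC_eq0) -e lead_coef_eq0.
Qed.

Lemma size_top g d : (0 < d)%N -> tdeg_le d g -> (size g).-1 = d ->
  size (top d g) = d.+1.
Proof.
move=> d0 hg sg; have [x x0 e] := lead_coef_tdeg d0 hg sg.
by rewrite /top size_poly_eq // subnn -sg -/(lead_coef g) e coefC.
Qed.

(* If the resultant has no root then it is constant, and its coefficient of
   degree [d * e], which is the resultant of the leading forms, vanishes. *)
Lemma common_zero g h d e : (0 < d)%N -> (0 < e)%N ->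
    tdeg_le d g -> tdeg_le e h -> (size g).-1 = d -> (size h).-1 = e ->
  (exists s z, ev g s z = 0 /\ ev h s z = 0) \/
  (exists z, (top d g).[z] = 0 /\ (top e h).[z] = 0).
Proof.
move=> d0 e0 hg hh sg sh.
have [x x0 lg] := lead_coef_tdeg d0 hg sg; have [y y0 lh] := lead_coef_tdeg e0 hh sh.
have [/eqP/size_poly1P [u u0 rE]|/closed_rootP [s /eqP rs]] :=
  eqVneq (size (resultant g h)) 1%N; [right|left].
  have [||_] := @resultant_coef_bound K g h d e d e (d * e) hg hh sg sh; [lia|lia|].
  rewrite rE coefC muln_eq0 -leqn0 leqNgt d0 -leqn0 leqNgt e0 /=.
  move=> /esym/eqP; have := resultantE (top d g) (top e h).
  rewrite !size_top // => <-; rewrite resultant_eq0; exact: common_root.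
exists s; suff: resultant (specialize s g) (specialize s h) == 0.
  rewrite resultant_eq0 => /common_root [z [gz hz]].
  by exists z; rewrite -!horner_specialize.
(* Specialization commutes with the resultant because both leading coefficients in [z] are nonzero
   constants. *)
by rewrite -map_resultant /= /horner_eval ?rs ?lg ?lh ?hornerC.
Qed.

(** If [f] and [p] were coprime, their resultant would be a nonzero polynomial in [s] of degree at
    most [d * e] vanishing at the first coordinates of all the points, which are distinct. *)
Lemma bezout f p d e (pts : seq (K * K)) :
    irr f -> tdeg_le d f -> tdeg_le e p -> uniq (map fst pts) ->
    (forall pt, pt \in pts -> ev f pt.1 pt.2 = 0 /\ ev p pt.1 pt.2 = 0) ->
    (d * e < size pts)%N ->
  exists q, p = q * f.
Proof.
move=> irrf hf hp upts hpts lt_de; have [sf _] := irrf.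
have [cop|] := boolP (coprimep f p); last exact: irr_dvd.
suff [r [r0 sr rpts]] : exists r : {poly K}, [/\ r != 0, (size r <= (d * e).+1)%N &
    forall pt, pt \in pts -> root r pt.1].
  have := max_poly_roots r0 _ upts; rewrite size_map => lt; have : (size pts < (d * e).+1)%N.
    apply: leq_trans (lt _) sr; apply/allP => s /mapP [pt /rpts ? ->] //.
  by rewrite ltnS leqNgt lt_de.
have sf' : (size f <= d.+1)%N := tdeg_le_size_outer hf.
have sp' : (size p <= e.+1)%N := tdeg_le_size_outer hp.
have d0 : (0 < d)%N by lia.
have p0 : p != 0.
  by apply: contraTneq cop => ->; rewrite coprimep0 -size_poly_eq1 neq_ltn sf orbT.
(* A polynomial [p] free of [z] serves as [r] itself; the resultant is used only when both degrees
   in [z] are positive. *)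
have [/size1_polyC pE|sp] := leqP (size p) 1.
  exists p`_0; split.
  - by rewrite -polyC_eq0 -pE.
  - by apply: leq_trans (size_coef_tdeg _ hp) _; nia.
  - by move=> pt /hpts [_]; rewrite {1}pE hornerC => /eqP.
exists (resultant f p); split.
- by move: cop; rewrite resultant_eq0 coprimep_def => /eqP ->.
- have la : ((size f).-1 <= d)%N by lia.
  have lb : ((size p).-1 <= e)%N by lia.
  have [|sr _] := @resultant_coef_bound K f p d e _ _ _ hf hp erefl erefl erefl.
    by move: (_.-1) (_.-1) la lb => x y; nia.
  apply: leq_trans sr _; rewrite ltnS.
  by move: (_.-1) (_.-1) la lb => x y; nia.
move=> pt /hpts [fpt ppt].
have [[u v] _ rE] := resultant_in_ideal sf sp.
have := congr1 (fun q : {poly {poly K}} => ev q pt.1 pt.2) rE.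
by rewrite /= !hornerE fpt ppt !mulr0 addr0 rootE => ->.
Qed.

(** * Interpolation with prescribed monomials *)

Definition mon i j : {poly {poly K}} := ('X^i)%:P * 'X^j.

Lemma coef_mon i j a b : (mon i j)`_b`_a = ((a == i) && (b == j))%:R.
Proof.
rewrite /mon coefCM coefXn; case: (b == j); last by rewrite mulr0 coef0 andbF.
by rewrite mulr1 coefXn andbT.
Qed.

Lemma ev_mon i j s z : ev (mon i j) s z = s ^+ i * z ^+ j.
Proof. by rewrite /mon hornerM hornerC hornerXn hornerM hornerXn -polyC_exp hornerC. Qed.

Lemma tdeg_le_coef n p : (forall i j, p`_j`_i != 0 -> (i + j <= n)%N) -> tdeg_le n p.
Proof.
by move=> h i j lt; apply/eqP; apply: contraTT lt => /h; rewrite -leqNgt.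
Qed.

(** Vanishing at the points is a homogeneous linear system with one unknown per monomial of [J],
    hence more unknowns than equations. *)
Lemma interpolate (J : seq (nat * nat)) (pts : seq (K * K)) :
    uniq J -> (size pts < size J)%N ->
  exists p, [/\ p != 0, forall i j, p`_j`_i != 0 -> (i, j) \in J &
                forall pt, pt \in pts -> ev p pt.1 pt.2 = 0].
Proof.
move=> uJ lt_sz; pose Jn i := nth (0, 0)%N J i; pose pn i := nth (0, 0) pts i.
pose M := \matrix_(i < size J, k < size pts) ((pn k).1 ^+ (Jn i).1 * (pn k).2 ^+ (Jn i).2).
have /rowV0Pn [v /sub_kermxP vM v0] : kermx M != 0.
  rewrite kermx_eq0 -row_leq_rank -ltnNge.
  exact: leq_ltn_trans (rank_leq_col _) lt_sz.
pose p := \sum_(i < size J) (v 0 i)%:P%:P * mon (Jn i).1 (Jn i).2.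
have coefp a b : p`_b`_a = \sum_(i < size J) v 0 i * ((a, b) == Jn i)%:R.
  rewrite !coef_sum; apply: eq_bigr => i _.
  by rewrite coefCM coefCM coef_mon; case: (Jn i) => x y; rewrite xpair_eqE.
exists p; split.
- have [i vi] : exists i, v 0 i != 0.
    apply/existsP; apply: contraNT v0; rewrite negb_exists => /forallP h.
    by apply/eqP/rowP => i; rewrite mxE; apply/eqP; have := h i; rewrite negbK.
  apply: contraNneq vi => p0; have := coefp (Jn i).1 (Jn i).2.
  rewrite p0 !coef0 (bigD1 i) //= -surjective_pairing eqxx mulr1 big1 ?addr0 => [<- //|k ki].
  have /negbTE ik : (i : nat) != k by rewrite eq_sym.
  by rewrite nth_uniq // ik mulr0.
- move=> a b; rewrite coefp => ne0; apply: contraNT ne0 => nJ.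
  apply/eqP; apply: big1 => i _; case: eqP => [e|]; last by rewrite mulr0.
  by case/negP: nJ; rewrite e mem_nth.
move=> pt ptin; have lt := ptin; rewrite -index_mem in lt.
have := congr1 (fun A : 'rV_(size pts) => A 0 (Ordinal lt)) vM.
rewrite !mxE => e; rewrite -[RHS]e /p horner_sum horner_sum; apply: eq_bigr => i _.
by rewrite hornerM hornerC hornerM hornerC ev_mon mxE /pn /= nth_index.
Qed.

End Intersection.

(** * Points failing to impose independent conditions *)

Definition triangle (e : nat) : seq (nat * nat) :=
  [seq u <- [seq (i, j) | i <- iota 0 e.+1, j <- iota 0 e.+1] | (u.1 + u.2 <= e)%N].

Lemma triangle_uniq e : uniq (triangle e).
Proof. by apply: filter_uniq; apply: allpairs_uniq; rewrite ?iota_uniq // => -[? ?] []. Qed.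

(** These are monomials not divisible by [s ^ i0 * z ^ j0], meant as the leading monomial of a
    cubic; [3 * e] is the dimension of polynomials of degree at most [e] modulo that cubic. *)
Lemma monomials_below i0 j0 e : (i0 + j0 = 3)%N -> (2 <= e)%N ->
  exists J : seq (nat * nat), [/\ uniq J, size J = (3 * e)%N &
    forall i j, (i, j) \in J -> (i + j <= e)%N && ((i < i0) || (j < j0))%N].
Proof.
move=> ij e2.
pose row j a l : seq (nat * nat) := [seq (i, j) | i <- iota a l].
pose col i a l : seq (nat * nat) := [seq (i, j) | j <- iota a l].
have row_uniq j a l : uniq (row j a l) by rewrite map_inj_uniq ?iota_uniq // => ? ? [].
have col_uniq i a l : uniq (col i a l) by rewrite map_inj_uniq ?iota_uniq // => ? ? [].
have row_mem j a l x y : ((x, y) \in row j a l) = (a <= x < a + l)%N && (y == j).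
  apply/mapP/andP => [[i]|[h /eqP ->]]; first by rewrite mem_iota => h [-> ->].
  by exists x; rewrite ?mem_iota.
have col_mem i a l x y : ((x, y) \in col i a l) = (a <= y < a + l)%N && (x == i).
  apply/mapP/andP => [[j]|[h /eqP ->]]; first by rewrite mem_iota => h [-> ->].
  by exists y; rewrite ?mem_iota.
have : [|| j0 == 3, j0 == 2, j0 == 1 | j0 == 0]%N by lia.
(* For each [j0], the rows [j < j0] and the columns [i < i0] started at height [j0] give three
   disjoint segments of lengths [e + 1], [e] and [e - 1]. *)
case/or4P => /eqP j0E;
[ exists (row 0 0 e.+1 ++ row 1 0 e ++ row 2 0 e.-1)%N
 | exists (row 0 0 e.+1 ++ row 1 0 e ++ col 0 2 e.-1)%N
 | exists (row 0 0 e.+1 ++ col 0 1 e ++ col 1 1 e.-1)%N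
 | exists (col 0 0 e.+1 ++ col 1 0 e ++ col 2 0 e.-1)%N ]; split;
  try (by rewrite !size_cat !size_map !size_iota; lia);
  try (by move=> x y; rewrite !mem_cat ?row_mem ?col_mem; lia);
  rewrite !cat_uniq ?row_uniq ?col_uniq /= !andbT; apply/andP;
  by split; apply/hasPn => -[x y]; rewrite ?mem_cat ?row_mem ?col_mem; lia.
Qed.

(** The monomial [s ^ (d - j0) * z ^ j0] is the leading one of [E] for total degree, then degree in
    [z]. It would divide the leading monomial of any nonzero multiple of [E], and no monomial of [A]
    is divisible by it. *)
Lemma not_multiple (R : idomainType) (E A : {poly {poly R}}) d (j0 := (size (top d E)).-1) :
    tdeg_le d E -> top d E != 0 -> A != 0 ->
    (forall i j, A`_j`_i != 0 -> (i < d - j0)%N || (j < j0)%N) ->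
  ~ exists q, A = q * E.
Proof.
move=> hE tE A0 hA [q AE]; have q0 : q != 0 by apply: contraNneq A0 => q0; rewrite AE q0 mul0r.
have [b [hq tq]] := exists_tdeg q0.
pose j1 := (size (top b q)).-1.
have sE : (size (top d E) <= d.+1)%N := size_poly _ _.
have sq : (size (top b q) <= b.+1)%N := size_poly _ _.
have : (top (b + d) A)`_(j1 + j0) != 0.
  have s1 : (0 < size (top b q))%N by rewrite size_poly_gt0.
  have s2 : (0 < size (top d E))%N by rewrite size_poly_gt0.
  have e : ((size (top b q) + size (top d E)).-2 = j1 + j0)%N by rewrite /j1 /j0; lia.
  have lc := lead_coefM (top b q) (top d E).
  rewrite {1}/lead_coef size_mul // e in lc.
  by rewrite AE topM // lc mulf_neq0 // lead_coef_eq0.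
rewrite AE coef_top; last exact: tdeg_leM.
rewrite -AE => /hA; have : (j0 <= d)%N by rewrite /j0; lia.
have : (j1 <= b)%N by rewrite /j1; lia.
lia.
Qed.

Section Relations.
Variables (K : closedFieldType) (I : finType) (s z : I -> K).
Hypothesis s_inj : injective s.
Implicit Types (p q : {poly {poly K}}) (c : I -> K).

Definition zeros p : {set I} := [set i | ev p (s i) (z i) == 0].
Definition supp c : {set I} := [set i | c i != 0].
Definition mulc c p : I -> K := fun i => c i * ev p (s i) (z i).

(* The points fail to impose independent conditions on curves of degree [m]:
   [c] is orthogonal to all polynomials of degree at most [m]. *)
Definition relation m c :=
  forall p, tdeg_le m p -> \sum_i c i * ev p (s i) (z i) = 0.

Lemma supp_mulc c p : supp (mulc c p) = supp c :\: zeros p.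
Proof. by apply/setP => i; rewrite !inE mulf_eq0 negb_or andbC. Qed.

Lemma card_supp_mulc c p :
  (#|supp (mulc c p)| = #|supp c| - #|supp c :&: zeros p|)%N.
Proof. by rewrite supp_mulc -[in RHS](cardsID (zeros p) (supp c)) addKn. Qed.

Lemma zerosM p q : zeros (p * q) = zeros p :|: zeros q.
Proof. by apply/setP => i; rewrite !inE !hornerM mulf_eq0. Qed.

Lemma relation_mulc m e c p : relation (m + e) c -> tdeg_le e p -> relation m (mulc c p).
Proof.
move=> rc hp q hq; rewrite -[RHS](rc (q * p)); last exact: tdeg_leM.
by apply: eq_bigr => i _; rewrite /mulc !hornerM; ring.
Qed.

Lemma relationW m n c : (n <= m)%N -> relation m c -> relation n c.
Proof. by move=> nm rc p hp; apply: rc; apply: tdeg_leW hp. Qed.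

(** Multiplying by [s - s i] lowers the degree by one and removes from the support the point [i]
    alone, by injectivity of [s]; another point [j] keeps the residual relation nonzero. *)
Lemma relation_weight m c : relation m c -> supp c != set0 -> (m + 2 <= #|supp c|)%N.
Proof.
elim: m c => [|m ih] c rc /set0Pn [j jc].
  rewrite leqNgt; apply/negP => lt2; have : supp c == [set j].
    by rewrite eq_sym eqEcard sub1set jc cards1; lia.
  move/eqP => sc; have := rc 1 (tdeg_le_const 1).
  under eq_bigr => i _ do rewrite -[1]/(1%:P : {poly {poly K}}) hornerC hornerC mulr1.
  rewrite (bigD1 j) //= big1 ?addr0 => [e|i ij]; first by rewrite inE e eqxx in jc.
  by apply/eqP; apply: contraNT ij => ci; rewrite -in_set1 -sc inE.
have [[i [ic ij]]|none] := pselect (exists i, i \in supp c /\ i != j).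
  pose p : {poly {poly K}} := ('X - (s i)%:P)%:P.
  have hp : tdeg_le 1 p.
    rewrite /p polyCB; apply: tdeg_leD; first exact: tdeg_le_s.
    by apply: tdeg_leN; apply: tdeg_leW (tdeg_le_const _).
  have evp k : ev p (s k) (z k) = s k - s i by rewrite hornerC hornerXsubC.
  have : (m + 2 <= #|supp (mulc c p)|)%N.
    apply: ih; first by apply: relation_mulc hp; rewrite addn1.
    apply/set0Pn; exists j; rewrite supp_mulc !inE evp subr_eq0.
    by rewrite (inj_eq s_inj) eq_sym ij; rewrite inE in jc.
  rewrite card_supp_mulc; have : (0 < #|supp c :&: zeros p|)%N.
    by apply/card_gt0P; exists i; rewrite inE ic inE evp subrr eqxx.
  have : (#|supp c :&: zeros p| <= #|supp c|)%N by rewrite subset_leq_card // subsetIl.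
  lia.
(* A support reduced to [j] already contradicts the bound in degree [m]. *)
have : (m + 2 <= #|supp c|)%N.
  by apply: ih; [apply: relationW rc | apply/set0Pn; exists j].
suff : (#|supp c| <= 1)%N by lia.
rewrite -(cards1 j) subset_leq_card //; apply/subsetP => i ic; rewrite inE.
by apply: contra_notT none => ij; exists i.
Qed.

(** Extremal choice for the inductions below: any curve found through residual points is compared
    with this one. *)
Lemma max_curve e (S : {set I}) : exists p, [/\ p != 0, tdeg_le e p &
  forall q, q != 0 -> tdeg_le e q -> (#|S :&: zeros q| <= #|S :&: zeros p|)%N].
Proof.
pose Q r := `[< exists p, [/\ p != 0, tdeg_le e p & #|S :&: zeros p| = r] >].
have exQ : exists r, Q r.
  exists #|S :&: zeros 1|; apply/asboolP; exists 1; split; rewrite ?oner_eq0 //.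
  exact: tdeg_leW (tdeg_le_const 1).
have bQ r : Q r -> (r <= #|S|)%N.
  by move/asboolP => [p [_ _ <-]]; rewrite subset_leq_card // subsetIl.
have [r /asboolP [p [p0 hp pr]] rmax] := ex_maxnP exQ bQ.
by exists p; split=> // q q0 hq; rewrite pr; apply: rmax; apply/asboolP; exists q.
Qed.

Lemma curve_through e (l : seq I) : (size l < size (triangle e))%N ->
  exists p, [/\ p != 0, tdeg_le e p & {subset l <= zeros p}].
Proof.
move=> sl; have := interpolate (pts := [seq (s i, z i) | i <- l]) (triangle_uniq e).
rewrite size_map => /(_ sl) [p [p0 hp hl]]; exists p; split=> //.
  by apply: tdeg_le_coef => i j /hp; rewrite mem_filter => /andP [].
by move=> i il; rewrite inE; apply/eqP; apply: (hl (s i, z i)); apply: map_f.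
Qed.

(** Dimension count, used with [k] equal to 2, 5, 9 for [e] equal to 1, 2, 3: one less than the
    number of monomials. *)
Lemma max_curve_card e k (S : {set I}) p : (k < size (triangle e))%N -> (k <= #|S|)%N ->
  (forall q, q != 0 -> tdeg_le e q -> (#|S :&: zeros q| <= #|S :&: zeros p|)%N) ->
  (k <= #|S :&: zeros p|)%N.
Proof.
move=> kt /card_geqP [l [ul sl lS]] pmax; rewrite -sl in kt *.
have [q [q0 hq lq]] := curve_through kt; apply: leq_trans (pmax q q0 hq).
by apply/card_geqP; exists l; split=> // i il; rewrite inE lS // lq.
Qed.

(** Induction on [m], removing a line with the most points. It has at least two, so the residual
    relation satisfies the same bound one degree lower. *)
Lemma relation_line m c : relation m c -> supp c != set0 -> (#|supp c| <= 2 * m + 1)%N ->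
  exists p, [/\ p != 0, tdeg_le 1 p & (m + 2 <= #|supp c :&: zeros p|)%N].
Proof.
elim: m c => [|m ih] c rc sc le_c; first by have := relation_weight rc sc; lia.
have [p [p0 hp pmax]] := max_curve 1 (supp c).
have wc := relation_weight rc sc.
have r2 : (2 <= #|supp c :&: zeros p|)%N by apply: max_curve_card pmax; [|lia].
exists p; split=> //.
have [e|ne] := eqVneq (supp (mulc c p)) set0.
  by move: (card_supp_mulc c p); rewrite e cards0; lia.
have rp : relation m (mulc c p) by apply: relation_mulc hp; rewrite addn1.
have card_p := card_supp_mulc c p.
have [|q [q0 hq hc]] := ih _ rp ne; first by rewrite card_p; lia.
have sub : (#|supp (mulc c p) :&: zeros q| <= #|supp c :&: zeros q|)%N.
  by rewrite subset_leq_card // setSI // supp_mulc subsetDl.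
have : (#|supp (mulc c p) :&: zeros q| <= #|supp (mulc c p)|)%N.
  by rewrite subset_leq_card // subsetIl.
(* By maximality [p] has at least the [m + 2] residual points of [q], and the two disjoint sets
   would give [2 * m + 4] points, one too many. *)
have := pmax q q0 hq; lia.
Qed.

End Relations.

(** * Relations in general position, and the dichotomy between a line and a conic *)

Section GeneralPosition.
Variables (K : closedFieldType) (I : finType) (s z : I -> K).
Hypothesis s_inj : injective s.
Implicit Types (p q : {poly {poly K}}) (c : I -> K).
Notation zeros := (zeros s z).
Notation mulc := (mulc s z).
Notation relation := (relation s z).

Lemma card_setI_le (A B : {set I}) : (#|A :&: B| <= #|A|)%N.
Proof. by rewrite subset_leq_card // subsetIl. Qed.

Lemma card_supp_mulcI c p (B : {set I}) :
  (#|supp (mulc c p) :&: B| + #|supp c :&: zeros p| <= #|supp c :&: (zeros p :|: B)|)%N.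
Proof.
rewrite supp_mulc -cardsUI.
have -> : (supp c :\: zeros p) :&: B :&: (supp c :&: zeros p) = set0.
  by apply/setP => i; rewrite !inE; case: (c i != 0); case: (_ == 0); rewrite ?andbF.
rewrite cards0 addn0 subset_leq_card //; apply/subsetP => i; rewrite !inE.
by case: (c i != 0); case: (_ == 0); case: (i \in B).
Qed.

(** A proper factorization would cover [S] by a line and a conic, that is by at most 2 + 5
    points. *)
Lemma cubic_irr (S : {set I}) E : tdeg_le 3 E -> E != 0 -> (8 <= #|S|)%N ->
    (forall p, p != 0 -> tdeg_le 1 p -> (#|S :&: zeros p| <= 2)%N) ->
    (forall p, p != 0 -> tdeg_le 2 p -> (#|S :&: zeros p| <= 5)%N) ->
    S \subset zeros E -> irr E.
Proof.
move=> hE E0 S8 lines conics SE; split.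
  (* A cubic free of [z] has at most three roots in [s], while the points of [S] have distinct first
     coordinates. *)
  rewrite ltnNge; apply/negP => /size1_polyC e.
  have c0 : E`_0 != 0 by rewrite -polyC_eq0 -e.
  have := max_poly_roots (rs := [seq s i | i <- enum S]) c0.
  rewrite map_inj_uniq // enum_uniq size_map -cardE => /(_ _ isT) lt.
  have := size_coef_tdeg 0 hE; suff : (#|S| < size (E`_0)%R)%N by lia.
  apply: lt; apply/allP => x /mapP [i]; rewrite mem_enum => iS ->.
  by have := subsetP SE i iS; rewrite inE e hornerC coefC.
move=> g h EE; have gh0 : g * h != 0 by rewrite -EE.
have := hE; rewrite EE => /tdeg_factor /(_ gh0) [d [e [de hg hh tg th]]].
have g0 : g != 0 by apply: contraNneq gh0 => ->; rewrite mul0r.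
have h0 : h != 0 by apply: contraNneq gh0 => ->; rewrite mulr0.
case: d => [|d] in de hg tg *; first by left; apply: tdeg_le_const_form.
case: e => [|e] in de hh th *; first by right; apply: tdeg_le_const_form.
have : (#|S| <= #|S :&: zeros g| + #|S :&: zeros h|)%N.
  rewrite -cardsUI -setIUr -zerosM -EE; move/setIidPl: SE => ->; exact: leq_addr.
have [d0|d1] : (d = 0 \/ d = 1)%N by lia.
  have := lines g g0; rewrite d0 in hg => /(_ hg).
  by have := conics h h0 (tdeg_leW _ hh); rewrite -ltnS; lia.
have := conics g g0 (tdeg_leW _ hg).
have := lines h h0 (tdeg_leW _ hh); lia.
Qed.

(** The [3 * e] monomials not divisible by the leading monomial of [E] leave one degree of freedom
    after [3 * e - 1] conditions, and [not_multiple] applies to any combination of them. *)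
Lemma curve_off_cubic (S : {set I}) E e : tdeg_le 3 E -> top 3 E != 0 -> (2 <= e)%N ->
  (3 * e - 1 <= #|S|)%N ->
  exists A, [/\ A != 0, tdeg_le e A, (3 * e - 1 <= #|S :&: zeros A|)%N &
                ~ exists q, A = q * E].
Proof.
move=> hE tE e2 /card_geqP [l [ul sl lS]].
pose j0 := (size (top 3 E)).-1; have j03 : (j0 <= 3)%N.
  by have : (size (top 3 E) <= 4)%N := size_poly _ _; rewrite /j0; lia.
have [J [uJ sJ hJ]] := @monomials_below (3 - j0) j0 e ltac:(lia) e2.
have [|A [A0 JA hA]] := interpolate (pts := [seq (s i, z i) | i <- l]) uJ.
  by rewrite size_map sl sJ; lia.
exists A; split=> //.
- by apply: tdeg_le_coef => i j /JA /hJ /andP [].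
- apply/card_geqP; exists l; split=> // i il; rewrite inE lS //= inE.
  by apply/eqP; apply: (hA (s i, z i)); apply: map_f.
- by apply: (not_multiple hE tE A0) => i j /JA /hJ /andP [].
Qed.

Lemma relation_general_position m c : relation m c -> supp c != set0 ->
    (forall p, p != 0 -> tdeg_le 1 p -> (#|supp c :&: zeros p| <= 2)%N) ->
    (forall p, p != 0 -> tdeg_le 2 p -> (#|supp c :&: zeros p| <= 5)%N) ->
  (3 * m <= #|supp c|)%N.
Proof.
have [n] := ubnP m; elim: n m c => // n ih m c mn rc sc lines conics.
have W := relation_weight s_inj rc sc.
(* A support this small has [k + 2] points on a line by [relation_line], which is impossible as soon
   as [k] is positive. *)
have W' k c' : relation k c' -> supp c' != set0 -> (#|supp c'| <= 2 * k + 1)%N ->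
    supp c' \subset supp c -> (k + 2 <= 2)%N.
  move=> rc' sc' le sub; have [p [p0 hp]] := relation_line s_inj rc' sc' le.
  have := lines p p0 hp; have : (#|supp c' :&: zeros p| <= #|supp c :&: zeros p|)%N.
    by rewrite subset_leq_card // setSI.
  lia.
have sub_mulc p : supp (mulc c p) \subset supp c by rewrite supp_mulc subsetDl.
have ih' e p : tdeg_le e p -> (0 < e <= m)%N -> supp (mulc c p) != set0 ->
    (3 * (m - e) <= #|supp (mulc c p)|)%N.
  move=> hp em sp; apply: ih => //; first by lia.
  - by apply: relation_mulc hp; rewrite subnK //; case/andP: em.
  - move=> q q0 hq; apply: leq_trans (lines q q0 hq).
    by rewrite subset_leq_card // setSI.
  - move=> q q0 hq; apply: leq_trans (conics q q0 hq).
    by rewrite subset_leq_card // setSI.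
rewrite leqNgt; apply/negP => lt_c.
have [m1|m2] := leqP m 1; first by lia.
have big : (2 * m + 2 <= #|supp c|)%N.
  by rewrite leqNgt; apply/negP => lt; have := W' m c rc sc ltac:(lia) (subxx _); lia.
have [C [C0 hC Cmax]] := max_curve s z 2 (supp c).
have C5 : (5 <= #|supp c :&: zeros C|)%N by apply: max_curve_card Cmax; [|lia].
have {}C5 : (#|supp c :&: zeros C| = 5)%N by have := conics C C0 hC; lia.
have cardC := card_supp_mulc s z c C.
have sC : supp (mulc c C) != set0 by rewrite -card_gt0; lia.
have := ih' 2%N C hC ltac:(lia) sC => leC.
(* Off the five points of [C] at least [3 * (m - 2)] remain, so a count below [3 * m] must be
   [3 * m - 1]. *)
have {lt_c} cE : (#|supp c| = 3 * m - 1)%N by lia.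
(* For [m <= 3] the [3 * m - 6] points off [C] are at most [2 * (m - 2) + 1], so [W'] applies. *)
have [m3|m4] := leqP m 3.
  have rC : relation (m - 2) (mulc c C) by apply: relation_mulc hC; rewrite subnK.
  have := W' _ _ rC sC ltac:(lia) (sub_mulc C); lia.
have [E [E0 hE Emax]] := max_curve s z 3 (supp c).
have E9 : (9 <= #|supp c :&: zeros E|)%N by apply: max_curve_card Emax; [|lia].
have cardE := card_supp_mulc s z c E.
(* Otherwise at least [3 * (m - 3)] points would lie off [E], but at most [3 * m - 10] are left. *)
have sE : supp (mulc c E) = set0.
  apply: contrapT => /eqP sE; have := ih' 3%N E hE ltac:(lia) sE; lia.
have {sE cardE} SE : supp c \subset zeros E.
  by rewrite -setD_eq0 -supp_mulc sE.
have irrE := @cubic_irr (supp c) E hE E0 ltac:(lia) lines conics SE.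
have tE : top 3 E != 0.
  apply/eqP => /(top_eq0 hE) /(_ E0) [_ /(conics E E0)].
  by move/setIidPl: SE => ->; lia.
(* In degree [m - 1] the curve [A] meets [3 * (m - 1) - 1] points, all but three. If it met all of
   them, [3 * m - 1 > 3 * (m - 1)] would make it a multiple of [E]. *)
have [A [A0 hA cA nA]] := @curve_off_cubic (supp c) E (m - 1) hE tE ltac:(lia) ltac:(lia).
have cardA := card_supp_mulc s z c A.
have [sA|sA] := eqVneq (supp (mulc c A)) set0.
  apply: nA; apply: (bezout (pts := [seq (s i, z i) | i <- enum (supp c)]) irrE hE hA).
  - by rewrite -map_comp map_inj_uniq ?enum_uniq.
  - move=> pt /mapP [i]; rewrite mem_enum => ic ->; split; apply/eqP.
      by have := subsetP SE i ic; rewrite inE.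
    have : i \in zeros A by apply: subsetP i ic; rewrite -setD_eq0 -supp_mulc sA.
    by rewrite inE.
  - by rewrite size_map -cardE cE; lia.
(* At most three points remain, with a nonzero relation in degree 1: they would be three points on a
   line. *)
have rA : relation 1 (mulc c A) by apply: relation_mulc hA; rewrite subnKC //; lia.
have := W' _ _ rA sA ltac:(lia) (sub_mulc A); lia.
Qed.

(** Induction on [m], removing a line with the most points if it has at least three of them, and
    otherwise a conic with the most points, which then has at least six: in both cases the residual
    support stays below three times the new degree. *)
Lemma relation_line_or_conic m c : relation m c -> supp c != set0 -> (#|supp c| < 3 * m)%N ->
  (exists p, [/\ p != 0, tdeg_le 1 p & (m + 2 <= #|supp c :&: zeros p|)%N]) \/
  (exists p, [/\ p != 0, tdeg_le 2 p & (2 * m + 2 <= #|supp c :&: zeros p|)%N]).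
Proof.
have [n] := ubnP m; elim: n m c => // n ih m c mn rc sc lt_c.
have W := relation_weight s_inj rc sc.
have [small|big] := leqP #|supp c| (2 * m + 1); first by left; apply: relation_line.
have [H [H0 hH Hmax]] := max_curve s z 1 (supp c).
have H2 : (2 <= #|supp c :&: zeros H|)%N by apply: max_curve_card Hmax; [|lia].
have cardH := card_supp_mulc s z c H.
have residual e C : tdeg_le e C -> (e <= m)%N -> supp (mulc c C) != set0 ->
    (m - e + 2 + #|supp c :&: zeros C| <= #|supp c|)%N.
  move=> hC em sC; have rC : relation (m - e) (mulc c C).
    by apply: relation_mulc hC; rewrite subnK.
  have := relation_weight s_inj rC sC; have := card_supp_mulc s z c C.
  by have := card_setI_le (supp c) (zeros C); lia.
have all_on C : supp (mulc c C) = set0 -> #|supp c :&: zeros C| = #|supp c|.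
  move=> /eqP; rewrite supp_mulc setD_eq0 => /setIidPl -> //.
have [r3|r2] := ltnP 2 #|supp c :&: zeros H|.
  have [sH|sH] := eqVneq (supp (mulc c H)) set0.
    by left; exists H; split=> //; rewrite all_on.
  have rH : relation (m - 1) (mulc c H) by apply: relation_mulc hH; rewrite subnK //; lia.
  have [||[p [p0 hp cp]]|[C [C0 hC cC]]] := ih _ _ _ rH sH; [lia|lia| |].
    (* The line [p] has [m + 1] residual points, and by maximality [H] has as many, so the conic
       [H * p] has [2 * m + 2]. *)
    right; exists (H * p); split; first by rewrite mulf_neq0.
      exact: (tdeg_leM hH hp).
    rewrite zerosM; apply: leq_trans (card_supp_mulcI c H (zeros p)).
    have := Hmax p p0 hp; have : (#|supp (mulc c H) :&: zeros p| <= #|supp c :&: zeros p|)%N.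
      by rewrite subset_leq_card // setSI // supp_mulc subsetDl.
    lia.
  right; exists C; split=> //.
  have le_C : (#|supp (mulc c H) :&: zeros C| <= #|supp c :&: zeros C|)%N.
    by rewrite subset_leq_card // setSI // supp_mulc subsetDl.
  (* The conic has at least [2 * m] points; a nonzero residual relation would add [m] more and reach
     [3 * m]. *)
  have [/all_on ->|sC] := eqVneq (supp (mulc c C)) set0; first by lia.
  by have := residual _ _ hC ltac:(lia) sC; lia.
have [C [C0 hC Cmax]] := max_curve s z 2 (supp c).
have [C6|C5] := ltnP 5 #|supp c :&: zeros C|; last first.
  have := relation_general_position rc sc.
  have l2 p : p != 0 -> tdeg_le 1 p -> (#|supp c :&: zeros p| <= 2)%N.
    by move=> p0 hp; apply: leq_trans (Hmax p p0 hp) r2.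
  have c5 p : p != 0 -> tdeg_le 2 p -> (#|supp c :&: zeros p| <= 5)%N.
    by move=> p0 hp; apply: leq_trans (Cmax p p0 hp) C5.
  by move=> /(_ l2 c5); lia.
right; exists C; split=> //.
have [/all_on ->|sC] := eqVneq (supp (mulc c C)) set0; first by lia.
have resC := residual _ _ hC ltac:(lia) sC; have cardC := card_supp_mulc s z c C.
have rC : relation (m - 2) (mulc c C) by apply: relation_mulc hC; rewrite subnK //; lia.
have [||[p [p0 hp cp]]|[C' [C'0 hC' cC']]] := ih _ _ _ rC sC; [lia|lia| |].
  (* A line with [m] points is excluded: [m] is at least 3 and lines have at most two points
     here. *)
  have := Hmax p p0 hp; have : (#|supp (mulc c C) :&: zeros p| <= #|supp c :&: zeros p|)%N.
    by rewrite subset_leq_card // setSI // supp_mulc subsetDl.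
  by lia.
(* By maximality [C] has the [2 * m - 2] points of [C'] at least, giving [4 * m - 4] in all: too
   many if [m >= 4]. If [m = 3], the six points of [C] and four others exceed 8. *)
have := Cmax C' C'0 hC'.
have : (#|supp (mulc c C) :&: zeros C'| <= #|supp c :&: zeros C'|)%N.
  by rewrite subset_leq_card // setSI // supp_mulc subsetDl.
have := card_setI_le (supp (mulc c C)) (zeros C').
by lia.
Qed.

End GeneralPosition.

(** * Polynomials in several variables *)

Lemma mlead_map_mpoly n (R S : nzRingType) (f : {rmorphism R -> S}) (p : {mpoly R[n]}) :
  injective f -> mlead (map_mpoly f p) = mlead p.
Proof.
move=> f_inj; have sp := perm_mem (msupp_map_mpoly p f_inj).
have [->|p0] := eqVneq p 0; first by rewrite raddf0 !mlead0.
have fp0 : map_mpoly f p != 0.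
  by rewrite -msupp_eq0 -size_eq0 (perm_size (msupp_map_mpoly p f_inj)) size_eq0 msupp_eq0.
by apply/eqP; rewrite eq_le !msupp_le_mlead -?sp ?mlead_supp // sp mlead_supp.
Qed.

Lemma map_mpoly_eq0 n (k K : fieldType) (iota : {rmorphism k -> K}) (p : {mpoly k[n]}) :
  (map_mpoly iota p == 0) = (p == 0).
Proof.
rewrite -(mleadc_eq0 (map_mpoly iota p)) mlead_map_mpoly ?mcoeff_map_mpoly; last exact: fmorph_inj.
by rewrite raddf_eq0 ?mleadc_eq0 //; apply: fmorph_inj.
Qed.

(** Leading-term division by [F] has coefficients in the small field. The leading monomial of [F]
    divides that of [A] because it does so over [K], and the remainder is again a multiple of [F]
    over [K]. *)
Lemma mpoly_dvd_descent n (k K : fieldType) (iota : {rmorphism k -> K})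
    (F A : {mpoly k[n]}) : F != 0 ->
  (exists Q, map_mpoly iota A = Q * map_mpoly iota F) -> exists Q, A = Q * F.
Proof.
move=> F0; have inj := fmorph_inj iota.
have map0 := map_mpoly_eq0 iota.
elim/mleadrect: A => A ih [Q AQ].
have [->|A0] := eqVneq A 0; first by exists 0; rewrite mul0r.
have Q0 : Q != 0.
  by apply: contraNneq A0 => Q0; rewrite -map0 AQ Q0 mul0r.
have lA : mlead A = (mlead Q + mlead F)%MM.
  by rewrite -(mlead_map_mpoly A inj) AQ mleadM ?map0 // mlead_map_mpoly.
move cE : (mleadc A) => c; pose T := (c / mleadc F) *: 'X_[mlead Q].
have lc : (T * F)@_(mlead A) = c.
  rewrite lA -[in LHS](mleadXm k (mlead Q)) -scalerAl mcoeffZ mleadcM.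
  by rewrite mleadXm mcoeffX eqxx mul1r divfK // mleadc_eq0.
have [e|A10] := eqVneq (A - T * F) 0.
  by exists T; apply/eqP; rewrite -subr_eq0 e.
have [] := ih (A - T * F).
- rewrite lt_neqAle; apply/andP; split.
    apply: contraNneq A10 => e.
    by rewrite -mleadc_eq0 e mcoeffB lc cE subrr.
  apply: le_trans (mleadB_le _ _) _; rewrite leUx lexx /= lA.
  apply: le_trans (mleadM_le _ _) _; apply: lem_add => //.
  by apply: le_trans (mleadZ_le _ _) _; rewrite mleadXm.
- exists (Q - map_mpoly iota T); rewrite mulrBl -AQ rmorphB rmorphM //.
by move=> Q1 e; exists (Q1 + T); rewrite mulrDl -e subrK.
Qed.

Section Evaluation.
Variable K : closedFieldType.

Definition o0 : 'I_3 := @Ordinal 3 0 isT.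
Definition o1 : 'I_3 := @Ordinal 3 1 isT.
Definition o2 : 'I_3 := @Ordinal 3 2 isT.

Lemma ord3P (P : 'I_3 -> Prop) : P o0 -> P o1 -> P o2 -> forall i, P i.
Proof.
move=> p0 p1 p2 [[|[|[|i]]] h] //.
- by rewrite (_ : Ordinal h = o0) //; apply: val_inj.
- by rewrite (_ : Ordinal h = o1) //; apply: val_inj.
- by rewrite (_ : Ordinal h = o2) //; apply: val_inj.
Qed.

Lemma big3 (R : Type) (idx : R) (op : Monoid.law idx) (F : 'I_3 -> R) :
  \big[op/idx]_i F i = op (F o0) (op (F o1) (F o2)).
Proof.
rewrite !big_ord_recl big_ord0 Monoid.mulm1.
by congr (op (F _) (op (F _) (F _))); apply: val_inj.
Qed.

(** At a root of ['X * p + 1] the polynomial [p] cannot vanish. *)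
Lemma poly_nonroot (p : {poly K}) : p != 0 -> exists x, p.[x] != 0.
Proof.
move=> p0; have /closed_rootP [x] : size ('X * p + 1) != 1%N.
  have sp : (1 < size ('X * p)%R)%N by rewrite mulrC size_mulX // ltnS size_poly_gt0.
  by rewrite size_polyDl ?size_poly1 // gtn_eqF.
move/rootP; rewrite hornerD hornerM hornerX hornerC => e.
exists x; apply/eqP => px; move/eqP: e.
by rewrite px mulr0 add0r oner_eq0.
Qed.

(* Kronecker substitution [X_i := x ^ (N ^ i)] with [N] larger than all exponents. *)
Lemma mpoly_nonzero_at (p : {mpoly K[3]}) : p != 0 -> exists v, p.@[v] != 0.
Proof.
move=> p0; pose N := msize p; pose w (m : 'X_{1..3}) := (\sum_i m i * N ^ i)%N.
pose q := \sum_(m <- msupp p) p@_m *: 'X^(w m).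
have small m i : m \in msupp p -> (m i < N)%N.
  move/msize_mdeg_lt; apply: leq_ltn_trans; rewrite mdegE (bigD1 i) //=; exact: leq_addr.
have w_inj m m' : m \in msupp p -> m' \in msupp p -> w m = w m' -> m = m'.
  move=> hm hm'; rewrite /w !big3 /= !expn0 !muln1 !expn1 => e.
  have {}e : (m o0 + (m o1 + m o2 * N) * N = m' o0 + (m' o1 + m' o2 * N) * N)%N by nia.
  have dig a b c d : (a < N)%N -> (c < N)%N -> (a + b * N = c + d * N)%N -> a = c /\ b = d.
    move=> aN cN eN; have N0 : (0 < N)%N by lia.
    have := congr1 (modn ^~ N) eN.
    rewrite [(a + _)%N]addnC [(c + _)%N]addnC !modnMDl !modn_small // => ac.
    by split=> //; move: eN; rewrite ac => /addnI/eqP; rewrite eqn_pmul2r // => /eqP.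
  have [e0 e'] := dig _ _ _ _ (small m o0 hm) (small m' o0 hm') e.
  have [e1 e2] := dig _ _ _ _ (small m o1 hm) (small m' o1 hm') e'.
  by apply/mnmP; apply: ord3P.
have q0 : q != 0.
  have ml := mlead_supp p0; apply: contraNneq p0 => q0.
  have := congr1 (fun r : {poly K} => r`_(w (mlead p))) q0.
  rewrite coef0 coef_sum (bigD1_seq (mlead p)) ?msupp_uniq //=.
  rewrite coefZ coefXn eqxx mulr1 big_seq_cond big1 ?addr0 => [/eqP|m /andP [ms ne]].
    by rewrite mleadc_eq0.
  rewrite coefZ coefXn; case: eqP => [e|]; last by rewrite mulr0.
  by rewrite (w_inj _ _ ml ms e) eqxx in ne.
have [x qx] := poly_nonroot q0; exists (fun i => x ^+ (N ^ i)%N).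
rewrite mevalE; suff <- : q.[x] = \sum_(m <- msupp p) p@_m * \prod_(i < 3) (x ^+ (N ^ i)%N) ^+ m i by [].
rewrite horner_sum; apply: eq_bigr => m _; rewrite hornerZ hornerXn; congr (_ * _).
rewrite /w expr_sum; apply: eq_bigr => i _.
by rewrite -exprM mulnC.
Qed.

Lemma meval_scale n d (A : {mpoly K[n]}) x v : A \is d.-homog ->
  A.@[fun i => x * v i] = x ^+ d * A.@[v].
Proof.
move=> /dhomogP hA; rewrite !mevalE mulr_sumr; apply: eq_big_seq => m /hA dm.
have {}dm : mdeg m = d := dm; rewrite mulrCA; congr (_ * _); rewrite -dm mdegE expr_sum -big_split /=.
by apply: eq_bigr => i _; rewrite exprMn.
Qed.

End Evaluation.

(** * Affine charts of smooth plane curves *)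

Lemma mderiv_map_mpoly n (R S : nzRingType) (f : {rmorphism R -> S}) i (p : {mpoly R[n]}) :
  map_mpoly f (mderiv i p) = mderiv i (map_mpoly f p).
Proof.
by apply/mpolyP => m; rewrite mcoeff_map_mpoly !mcoeff_mderiv mcoeff_map_mpoly raddfMn.
Qed.

Section Chart.
Variables (K : closedFieldType) (al be t : K).
Implicit Types (f g h p q : {poly {poly K}}) (A B F : {mpoly K[3]}).

(* The point with homogeneous coordinates [x : y : z] in the frame
   [(1, 0, 0), (- t, 1, 0), (al, be, 1)]. *)
Definition point (x y z : K) (i : 'I_3) : K :=
  nth 0 [:: x - t * y + al * z; y + be * z; z] i.

(** With ['X_o2], the forms [form0] and [form1] are the coordinates in the frame of [point], as
    [pointK] states. *)
Definition form1 : {mpoly K[3]} := 'X_o1 - be *: 'X_o2.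
Definition form0 : {mpoly K[3]} := 'X_o0 - al *: 'X_o2 + t *: form1.

Lemma form1E v : form1.@[v] = v o1 - be * v o2.
Proof. by rewrite mevalB mevalZ !mevalXU. Qed.

Lemma form0E v : form0.@[v] = v o0 - al * v o2 + t * (v o1 - be * v o2).
Proof. by rewrite mevalD mevalB !mevalZ form1E !mevalXU. Qed.

Lemma form1_point x y z : form1.@[point x y z] = y.
Proof. by rewrite form1E /point /= addrK. Qed.

Lemma form0_point x y z : form0.@[point x y z] = x.
Proof. by rewrite form0E /point /=; ring. Qed.

Lemma pointK v : point form0.@[v] form1.@[v] (v o2) =1 v.
Proof. by apply: ord3P; rewrite /point ?form0E ?form1E /=; ring. Qed.

Lemma form0_neq0 : form0 != 0.
Proof.
apply/eqP => e; have := form0_point 1 0 0; rewrite e meval0 => /eqP.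
by rewrite eq_sym oner_eq0.
Qed.

(** Density of the chart: a point where [form0 * (A - B)] does not vanish lies in the chart. *)
Lemma mpoly_chart_ext A B :
  (forall x y z, x != 0 -> A.@[point x y z] = B.@[point x y z]) -> A = B.
Proof.
move=> AB; apply/eqP; rewrite -subr_eq0.
have : form0 * (A - B) == 0.
  apply: contraT => /mpoly_nonzero_at [v]; rewrite mevalM mulf_eq0 negb_or => /andP [x0].
  by rewrite mevalB -(meval_eq A (pointK v)) -(meval_eq B (pointK v)) AB // subrr eqxx.
by rewrite mulf_eq0 (negPf form0_neq0).
Qed.

Definition dehomog A : {poly {poly K}} :=
  mmap (polyC \o polyC) (fun i : 'I_3 => nth 0
    [:: 1 - t%:P%:P * 'X%:P + al%:P%:P * 'X; 'X%:P + be%:P%:P * 'X; 'X] i) A.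

Lemma dehomogM A B : dehomog (A * B) = dehomog A * dehomog B.
Proof. exact: rmorphM. Qed.

Lemma ev_dehomog A s z : ev (dehomog A) s z = A.@[point 1 s z].
Proof.
rewrite mevalE /dehomog /mmap !horner_sum; apply: eq_bigr => m _.
rewrite /= hornerM hornerC hornerM hornerC; congr (_ * _).
rewrite /mmap1 !horner_prod; apply: eq_bigr => i _; rewrite !horner_exp; congr (_ ^+ _).
by move: i; apply: ord3P; rewrite /point /=; rewrite !hornerE ?mulr1.
Qed.

Lemma tdeg_dehomog d A : A \is d.-homog -> tdeg_le d (dehomog A).
Proof.
move=> /dhomogP hA; rewrite /dehomog /mmap big_seq_cond.
apply: tdeg_le_sum => m /andP [/hA dm _]; have {}dm : mdeg m = d := dm.
apply: tdeg_leZ; rewrite -dm mdegE /mmap1.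
elim: (index_enum _) => [|i r ih]; first by rewrite !big_nil; apply: tdeg_le_const.
rewrite !big_cons; apply: tdeg_leM => //.
apply: (@tdeg_leW _ (1 * m i)); first by rewrite mul1n.
apply: tdeg_leX.
move: {ih} i; apply: ord3P; rewrite /=.
- apply: tdeg_leD; last by apply: tdeg_leZ; apply: tdeg_le_z.
  apply: tdeg_leD; first exact: tdeg_leW (tdeg_le_const 1).
  by apply: tdeg_leN; apply: tdeg_leZ; apply: tdeg_le_s.
- by apply: tdeg_leD; [exact: tdeg_le_s | apply: tdeg_leZ; apply: tdeg_le_z].
- exact: tdeg_le_z.
Qed.

(** Truncation in [d - (i + j)] is harmless under [tdeg_le d g], since the coefficients with
    [i + j > d] are zero. *)
Definition homogenize d g : {mpoly K[3]} :=
  \sum_(j < d.+1) \sum_(i < d.+1)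
    g`_j`_i *: (form0 ^+ (d - (i + j)) * form1 ^+ i * 'X_o2 ^+ j).

Lemma homogenizeE d g x y z : (homogenize d g).@[point x y z] =
  \sum_(j < d.+1) \sum_(i < d.+1) g`_j`_i * (x ^+ (d - (i + j)) * y ^+ i * z ^+ j).
Proof.
rewrite /homogenize raddf_sum; apply: eq_bigr => j _ /=.
rewrite raddf_sum; apply: eq_bigr => i _ /=.
rewrite mevalZ !mevalM; congr (_ * (_ * _ * _)).
- by rewrite rmorphXn /= form0_point.
- by rewrite rmorphXn /= form1_point.
- by rewrite rmorphXn /= mevalXU.
Qed.

Lemma homogenize_homog d g : tdeg_le d g -> homogenize d g \is d.-homog.
Proof.
have X1 i : ('X_i : {mpoly K[3]}) \is 1.-homog by rewrite dhomogX; apply/eqP/mdeg1.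
have h1 : form1 \is 1.-homog by rewrite rpredB ?rpredZ.
have h0 : form0 \is 1.-homog by rewrite rpredD ?rpredB ?rpredZ.
move=> hg; apply: rpred_sum => j _; apply: rpred_sum => i _.
have [lt|le] := ltnP d (i + j); first by rewrite hg // scale0r rpred0.
apply: rpredZ; have := dhomogM (dhomogM (dhomogMn (d - (i + j)) h0) (dhomogMn i h1))
  (dhomogMn j (X1 o2)).
by rewrite !mul1n (_ : d - (i + j) + i + j = d)%N //; lia.
Qed.

Lemma ev_sum d g s z : tdeg_le d g ->
  ev g s z = \sum_(j < d.+1) \sum_(i < d.+1) g`_j`_i * (s ^+ i * z ^+ j).
Proof.
move=> hg; rewrite (horner_coef_wide _ (tdeg_le_size_outer hg)) horner_sum.
apply: eq_bigr => j _; rewrite hornerM -polyC_exp hornerC.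
rewrite (@horner_coef_wide _ d.+1); last first.
  by apply: leq_trans (size_coef_tdeg _ hg) _; apply: leq_subr.
by rewrite mulr_suml; apply: eq_bigr => i _; rewrite mulrA.
Qed.

Lemma homogenize_affine d g x y z : tdeg_le d g -> x != 0 ->
  (homogenize d g).@[point x y z] = x ^+ d * ev g (y / x) (z / x).
Proof.
move=> hg x0; rewrite homogenizeE (ev_sum _ _ hg) mulr_sumr.
apply: eq_bigr => j _; rewrite mulr_sumr; apply: eq_bigr => i _.
have [lt|le] := ltnP d (i + j); first by rewrite hg // !mul0r mulr0.
rewrite [RHS]mulrCA; congr (_ * _); rewrite !expr_div_n.
have -> : x ^+ d = x ^+ (d - (i + j)) * (x ^+ i * x ^+ j).
  by rewrite -!exprD; congr (_ ^+ _); lia.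
by field; rewrite !expf_neq0 ?x0.
Qed.

Lemma homogenize_infinity d g z : tdeg_le d g ->
  (homogenize d g).@[point 0 1 z] = (top d g).[z].
Proof.
move=> hg; rewrite homogenizeE (horner_coef_wide _ (size_poly _ _)).
apply: eq_bigr => j _; rewrite coef_top //; have lj := ltn_ord j.
have li : (d - j < d.+1)%N by lia.
rewrite (bigD1 (Ordinal li)) //= big1 => [|i ne].
  rewrite addr0 (_ : d - (d - j + j) = 0)%N; last by lia.
  by rewrite expr0 expr1n !mul1r.
have {}ne : (i : nat) <> (d - j)%N by move=> e; case/eqP: ne; apply: val_inj.
have [lt|le] := ltnP d (i + j); first by rewrite hg // mul0r.
rewrite (_ : d - (i + j) = (d - (i + j)).-1.+1)%N; last by lia.
by rewrite exprS !mul0r mulr0.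
Qed.

Lemma homogenize_vertical d g : tdeg_le d g ->
  (homogenize d g).@[point 0 0 1] = g`_d`_0.
Proof.
move=> hg; rewrite homogenizeE (bigD1 ord_max) //= (bigD1 ord0) //= !big1.
- by rewrite !addr0 add0n subnn !expr0 expr1n !mulr1.
- move=> j ne; have {}ne : (j : nat) <> d by move=> e; case/eqP: ne; apply: val_inj.
  have lj := ltn_ord j; apply: big1 => i _.
  have [lt|le] := ltnP d (i + j); first by rewrite hg // mul0r.
  case: (nat_of_ord i) le => [|i'] le; last by rewrite exprS !mul0r mulr0 mul0r mulr0.
  rewrite (_ : d - (0 + j) = (d - j).-1.+1)%N; last by lia.
  by rewrite exprS !mul0r mulr0.
- move=> i ne; rewrite (_ : g`_d`_i = 0) ?mul0r // hg //.
  have : (0 < i)%N by rewrite lt0n; apply: contraNneq ne => e; apply/eqP/val_inj.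
  by lia.
Qed.

Lemma meval_chart d A x y z : A \is d.-homog -> x != 0 ->
  A.@[point x y z] = x ^+ d * ev (dehomog A) (y / x) (z / x).
Proof.
move=> hA x0; rewrite ev_dehomog -(meval_scale _ _ hA); apply: meval_eq.
by apply: ord3P; rewrite /point /=; field.
Qed.

Lemma dehomogK d A : A \is d.-homog -> homogenize d (dehomog A) = A.
Proof.
move=> hA; apply: mpoly_chart_ext => x y z x0.
by rewrite (meval_chart _ _ hA x0) (homogenize_affine _ _ (tdeg_dehomog hA) x0).
Qed.

Lemma homogenizeM d e g h : tdeg_le d g -> tdeg_le e h ->
  homogenize (d + e) (g * h) = homogenize d g * homogenize e h.
Proof.
move=> hg hh; apply: mpoly_chart_ext => x y z x0.
rewrite mevalM !homogenize_affine //; last exact: tdeg_leM.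
by rewrite hornerM hornerM exprD; ring.
Qed.

(** * Irreducibility and divisibility for a curve that misses the centre of projection *)

Section Curve.
Variables (a : nat) (F : {mpoly K[3]}).
Hypotheses (F_homog : F \is (a.-homog)) (F_vertical : F.@[point 0 0 1] != 0).

Lemma coef_dehomog_vertical : (dehomog F)`_a`_0 != 0.
Proof. by rewrite -(homogenize_vertical (tdeg_dehomog F_homog)) dehomogK. Qed.

Lemma size_dehomog : size (dehomog F) = a.+1.
Proof.
apply/anti_leq; rewrite (tdeg_le_size_outer (tdeg_dehomog F_homog)) /=.
rewrite ltnNge; apply: contra coef_dehomog_vertical => le.
by rewrite (nth_default 0 le) coef0.
Qed.

(** Two curves of positive degree meet in the projective plane: [common_zero] gives the two factors
    a common zero, affine or at infinity, and homogenizing contradicts the hypothesis on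
    factorizations of [F]. *)
Lemma dehomog_irr : (0 < a)%N ->
    (forall G H v, F = G * H -> (exists i, v i != 0) -> G.@[v] = 0 -> H.@[v] <> 0) ->
  irr (dehomog F).
Proof.
move=> a0 sing; split=> [|g h fE]; first by rewrite size_dehomog ltnS.
have f0 : g * h != 0 by rewrite -fE -size_poly_gt0 size_dehomog.
have g0 : g != 0 by apply: contraNneq f0 => ->; rewrite mul0r.
have h0 : h != 0 by apply: contraNneq f0 => ->; rewrite mulr0.
have := tdeg_dehomog F_homog; rewrite fE => /tdeg_factor /(_ f0) [d [e [de hg hh _ _]]].
have sg := tdeg_le_size_outer hg; have sh := tdeg_le_size_outer hh.
have := size_dehomog; rewrite fE size_mul // => sz.
have pg : (0 < size g)%N by rewrite size_poly_gt0.
have ph : (0 < size h)%N by rewrite size_poly_gt0.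
have [d0|d0] := posnP d; first by left; apply: tdeg_le_const_form; rewrite -d0.
have [e0|e0] := posnP e; first by right; apply: tdeg_le_const_form; rewrite -e0.
(* The degrees in [z] add up to [a] and the total degrees to at most [a], so each factor has its
   total degree as degree in [z], as [common_zero] requires. *)
have aE : a = (d + e)%N by move: (size g) (size h) sg sh sz pg ph => u v; lia.
have gd : (size g).-1 = d by move: (size g) (size h) sg sh sz pg ph => u v; lia.
have hd : (size h).-1 = e by move: (size g) (size h) sg sh sz pg ph => u v; lia.
have FE : F = homogenize d g * homogenize e h.
  by rewrite -homogenizeM // -fE -aE dehomogK.
exfalso; case: (common_zero d0 e0 hg hh gd hd) => [[s [z [gz hz]]]|[z [gz hz]]].
  apply: (sing _ _ (point 1 s z) FE).
  - apply: contrapT => none; have [z0 y0] : point 1 s z o2 = 0 /\ point 1 s z o1 = 0.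
      by split; apply/eqP; apply: contrapT => /negP ne; apply: none; eexists; exact: ne.
    apply: none; exists o0; move: z0 y0; rewrite /point /= => -> .
    by rewrite mulr0 addr0 => ->; rewrite !mulr0 subr0 addr0 oner_eq0.
  - by rewrite homogenize_affine ?oner_eq0 // !divr1 gz mulr0.
  - by rewrite homogenize_affine ?oner_eq0 // !divr1 hz mulr0.
apply: (sing _ _ (point 0 1 z) FE).
- have [z0|z0] := eqVneq z 0; last by exists o2.
  by exists o1; rewrite /point /= z0 mulr0 addr0 oner_eq0.
- by rewrite homogenize_infinity.
- by rewrite homogenize_infinity.
Qed.

Lemma dvd_dehomog d A : A \is d.-homog ->
  (exists q, dehomog A = q * dehomog F) -> exists Q, A = Q * F.
Proof.
move=> hA [q AE]; have [A0|A0] := eqVneq (dehomog A) 0.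
  exists 0; rewrite mul0r -(dehomogK hA) A0 /homogenize.
  by apply: big1 => j _; apply: big1 => i _; rewrite !coef0 scale0r.
have := tdeg_dehomog hA; rewrite AE => /tdeg_factor; rewrite -AE => /(_ A0).
move=> [d1 [e [le hq he _ _]]].
have ae : (a <= e)%N by have := tdeg_le_size_outer he; rewrite size_dehomog.
exists (homogenize (d - a) q); rewrite -{1}(dehomogK hA) AE.
have {1}-> : d = ((d - a) + a)%N by lia.
rewrite homogenizeM ?dehomogK //; last exact: tdeg_dehomog.
by apply: tdeg_leW hq; lia.
Qed.

Lemma homog_prime d e A B : irr (dehomog F) -> A \is d.-homog -> B \is e.-homog ->
  (exists Q, A * B = Q * F) -> (exists Q, A = Q * F) \/ (exists Q, B = Q * F).
Proof.
move=> irrF hA hB [Q e']; have := congr1 dehomog e'; rewrite !dehomogM.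
move=> /(irr_prime irrF) [h|h]; [left|right]; [exact: (dvd_dehomog hA h)|exact: (dvd_dehomog hB h)].
Qed.

End Curve.
End Chart.

(** * A chart containing all the points, with distinct first coordinates *)

Section GoodChart.
Variable K : closedFieldType.
Implicit Types u v w : 'I_3 -> K.

(** As a form in [w] this is the determinant of [u], [v], [w], the equation of the line joining [u]
    and [v]. *)
Definition det_form u v : {mpoly K[3]} :=
  (u o1 * v o2 - u o2 * v o1) *: 'X_o0 + (u o2 * v o0 - u o0 * v o2) *: 'X_o1
    + (u o0 * v o1 - u o1 * v o0) *: 'X_o2.

Lemma det_formE u v w : (det_form u v).@[w] =
  (u o1 * v o2 - u o2 * v o1) * w o0 + (u o2 * v o0 - u o0 * v o2) * w o1
    + (u o0 * v o1 - u o1 * v o0) * w o2.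
Proof. by rewrite !mevalD !mevalZ !mevalXU. Qed.

Lemma det_form_neq0 u v : (exists i, u i != 0) -> (exists i, v i != 0) ->
  ~ (exists c, c != 0 /\ forall i, u i = c * v i) -> det_form u v != 0.
Proof.
move=> [i ui] [j vj] indep; apply/eqP => e; apply: indep.
have E w := congr1 (fun p : {mpoly K[3]} => p.@[w]) e.
have e0 : u o1 * v o2 = u o2 * v o1.
  apply/eqP; rewrite -subr_eq0; have := E (fun l => (l == o0)%:R).
  by rewrite /= det_formE meval0 /= !(mulr1, mulr0, addr0, add0r) => ->.
have e1 : u o2 * v o0 = u o0 * v o2.
  apply/eqP; rewrite -subr_eq0; have := E (fun l => (l == o1)%:R).
  by rewrite /= det_formE meval0 /= !(mulr1, mulr0, addr0, add0r) => ->.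
have e2 : u o0 * v o1 = u o1 * v o0.
  apply/eqP; rewrite -subr_eq0; have := E (fun l => (l == o2)%:R).
  by rewrite /= det_formE meval0 /= !(mulr1, mulr0, addr0, add0r) => ->.
have sym l m : u l * v m = u m * v l by move: l m; do 2![apply: ord3P].
have uE l : u l = u j / v j * v l by rewrite mulrAC sym mulfK.
exists (u j / v j); split=> //.
by apply: contraNneq ui => c0; rewrite uE c0 mul0r.
Qed.

(** A centre [w] is chosen off the curve, the points and the lines joining them. Then [t] selects a
    line through [w], to be sent to infinity, that avoids the points. The first coordinate
    parametrizes the lines through [w], hence separates the points. *)
Lemma good_chart n a (F : {mpoly K[3]}) (v : 'I_n -> 'I_3 -> K) :
    F \is (a.-homog) -> F != 0 -> (forall i, exists l, v i l != 0) ->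
    (forall i j, i != j -> ~ exists c, c != 0 /\ forall l, v i l = c * v j l) ->
  exists al be t : K, [/\ F.@[point al be t 0 0 1] != 0,
    forall i, (form0 al be t).@[v i] != 0 &
    injective (fun i => (form1 be).@[v i] / (form0 al be t).@[v i])].
Proof.
move=> hF F0 v0 vij.
(* [D i] keeps [w] away from [v i]; when [v i o2 = 0] the condition [w o2 != 0] suffices. *)
pose D i : {mpoly K[3]} := if v i o2 == 0 then 1 else v i o0 *: 'X_o2 - v i o2 *: 'X_o0.
have D0 i : D i != 0.
  rewrite /D; case: (eqVneq (v i o2) 0) => [_|v2]; first exact: oner_neq0.
  apply: contraNneq v2 => e; have := congr1 (fun p : {mpoly K[3]} => p.@[fun l => (l == o0)%:R]) e.
  rewrite /= mevalB !mevalZ !mevalXU meval0 /= mulr0 mulr1 sub0r => /eqP.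
  by rewrite oppr_eq0.
pose Phi := F * 'X_o2 * \prod_i D i * \prod_(ij | ij.1 != ij.2) det_form (v ij.1) (v ij.2).
have Phi0 : Phi != 0.
  rewrite !mulf_neq0 //.
  - apply/eqP => e; have := congr1 (fun p : {mpoly K[3]} => p.@[fun l => 1]) e.
    by rewrite /= mevalXU meval0 => /eqP; rewrite oner_eq0.
  - by apply/prodf_neq0 => i _.
  - by apply/prodf_neq0 => ij ne; apply: det_form_neq0 => //; apply: vij.
have [w] := mpoly_nonzero_at Phi0.
rewrite !mevalM !mulf_eq0 !negb_or mevalXU => /andP [/andP [/andP [Fw w2] Dw] Cw].
pose al := w o0 / w o2; pose be := w o1 / w o2.
have wE : w =1 fun i => w o2 * point al be 0 0 0 1 i.
  by apply: ord3P; rewrite /point /al /be /=; field.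
(* The factor of index [i] is [form0] at [v i], as a polynomial in [t]. *)
pose q := \prod_i ((v i o0 - al * v i o2)%:P + (v i o1 - be * v i o2)%:P * 'X).
have q0 : q != 0.
  apply/prodf_neq0 => i _; apply/eqP => e.
  have := congr1 (fun r : {poly K} => r`_0) e; have := congr1 (fun r : {poly K} => r`_1) e.
  rewrite !coefD !coefC !coefMX !coefC /= add0r addr0 => /eqP; rewrite subr_eq0 => /eqP v1.
  move=> /eqP; rewrite subr_eq0 => /eqP v0E.
  have v2 : v i o2 != 0.
    apply/eqP => v2; have [l] := v0 i; move: l; apply: ord3P; rewrite ?v0E ?v1 v2 ?mulr0 ?eqxx //.
  have : (D i).@[w] != 0.
    apply: contraNneq Dw => e'; rewrite rmorph_prod /=; apply/eqP.
    by rewrite (bigD1 i) //= e' mul0r.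
  rewrite /D (negPf v2) mevalB !mevalZ !mevalXU v0E /al.
  by case/eqP; field.
have [t qt] := poly_nonroot q0.
have x0 i : (form0 al be t).@[v i] != 0.
  apply: contraNneq qt => e; rewrite /q horner_prod (bigD1 i) //= [X in X * _](_ : _ = 0) ?mul0r //.
  by rewrite -e form0E hornerD hornerM !hornerC hornerX; ring.
exists al, be, t; split=> //.
  have -> : F.@[point al be t 0 0 1] = F.@[point al be 0 0 0 1].
    by apply: meval_eq; apply: ord3P; rewrite /point /=; ring.
  apply: contraNneq Fw => e; rewrite (meval_eq _ wE) (meval_scale _ _ hF).
  by rewrite e mulr0.
move=> i j e; apply/eqP; apply: contraT => ij.
have : (det_form (v i) (v j)).@[w] != 0.
  apply: contraNneq Cw => e'; rewrite rmorph_prod /=; apply/eqP.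
  by rewrite (bigD1 (i, j)) //= e' mul0r.
case/eqP; rewrite det_formE !(wE o0, wE o1) /point /=.
move: e => /eqP; rewrite eqr_div // => /eqP; rewrite !form0E !form1E => e.
(* Equality of the two first coordinates makes this cross difference vanish; the terms in [t] cancel
   and leave the determinant. *)
transitivity (w o2 * ((v j o1 - be * v j o2) * (v i o0 - al * v i o2 + t * (v i o1 - be * v i o2))
   - (v i o1 - be * v i o2) * (v j o0 - al * v j o2 + t * (v j o1 - be * v j o2)))); first by ring.
by rewrite e; ring.
Qed.

End GoodChart.

(** * Functions with poles bounded by the pullback of a line *)

Lemma dhomog_map n d (R S : nzRingType) (f : {rmorphism R -> S}) (p : {mpoly R[n]}) :
  p \is d.-homog -> map_mpoly f p \is d.-homog.
Proof.
move=> /dhomogP hp; apply/dhomogP => m; rewrite mcoeff_msupp mcoeff_map_mpoly => fm.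
by apply: hp; rewrite mcoeff_msupp; apply: contraNneq fm => ->; rewrite raddf0.
Qed.

Lemma dhomog_cast n d e (R : nzRingType) (p : {mpoly R[n]}) :
  d = e -> p \is d.-homog -> p \is e.-homog.
Proof. by move=> ->. Qed.

Lemma meval_map n (R S : comNzRingType) (f : {rmorphism R -> S}) (p : {mpoly R[n]}) v :
  injective f -> (map_mpoly f p).@[fun i => f (v i)] = f p.@[v].
Proof.
move=> f_inj; rewrite !mevalE rmorph_sum /= (perm_big _ (msupp_map_mpoly p f_inj)) /=.
apply: eq_bigr => m _; rewrite mcoeff_map_mpoly rmorphM rmorph_prod; congr (_ * _).
by apply: eq_bigr => i _; rewrite rmorphXn.
Qed.

Lemma row_coord (R : nzRingType) n (P : 'rV[R]_n) : P != 0 -> exists i, P 0 i != 0.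
Proof.
move=> P0; apply: contrapT => none; case/eqP: P0; apply/rowP => i; rewrite mxE.
by apply/eqP; apply: contrapT => /negP ne; apply: none; exists i.
Qed.

(** * Consequences of smoothness: primality of the equation over [k] *)

Section SmoothCurve.
Variables (k : fieldType) (K : closedFieldType) (iota : {rmorphism k -> K}).
Variables (a : nat) (F : {mpoly k[3]}).
Hypotheses (a_gt1 : (1 < a)%N) (F_homog : F \is (a.-homog)).
Hypothesis X_smooth : smooth_curve iota F.
Notation FK := (map_mpoly iota F).

Lemma FK_homog : FK \is (a.-homog).
Proof. exact: dhomog_map. Qed.

Lemma gevalE A (v : 'I_3 -> K) : geval iota A (\row_l v l) = (map_mpoly iota A).@[v].
Proof. by apply: meval_eq => l; rewrite mxE. Qed.

Lemma gevalM A B P : geval iota (A * B) P = geval iota A P * geval iota B P.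
Proof. by rewrite /geval rmorphM mevalM. Qed.

Lemma gevalB A B P : geval iota (A - B) P = geval iota A P - geval iota B P.
Proof. by rewrite /geval rmorphB mevalB. Qed.

Lemma on_curve_row v : (exists i, v i != 0) -> FK.@[v] = 0 ->
  on_curve iota F (\row_l v l).
Proof.
move=> [i vi] Fv; split; last by rewrite gevalE.
by apply: contraNneq vi => /rowP /(_ i); rewrite !mxE => ->.
Qed.

Lemma smooth_neq0 : F != 0.
Proof.
apply/eqP => F0; have [|i] := X_smooth (P := \row_l 1).
  apply: on_curve_row; first by exists o0; rewrite oner_eq0.
  by rewrite F0 raddf0 meval0.
by rewrite F0 mderiv0 /geval raddf0 meval0 eqxx.
Qed.

(** By Leibniz all partial derivatives of a product vanish at a common zero of its factors. *)
Lemma smooth_no_node G H v : FK = G * H -> (exists i, v i != 0) ->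
  G.@[v] = 0 -> H.@[v] <> 0.
Proof.
move=> FE v0 Gv Hv.
have [|i] := X_smooth (P := \row_l v l).
  by apply: on_curve_row; rewrite // FE mevalM Gv mul0r.
rewrite gevalE mderiv_map_mpoly FE mderivM mevalD !mevalM Gv Hv.
by rewrite mul0r mulr0 addr0 eqxx.
Qed.

Lemma smooth_irr al be t : FK.@[point al be t 0 0 1] != 0 -> irr (dehomog al be t FK).
Proof.
move=> Fv; apply: (dehomog_irr FK_homog Fv); first exact: ltnW.
exact: smooth_no_node.
Qed.

(** Primality holds over [K] in a chart and descends to [k] by leading-term division. *)
Lemma curve_prime d e A B : A \is d.-homog -> B \is e.-homog ->
  curve_dvd F (A * B) -> curve_dvd F A \/ curve_dvd F B.
Proof.
move=> hA hB [Q AB].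
have FK0 : FK != 0 by rewrite map_mpoly_eq0 smooth_neq0.
(* With an empty family of points, [good_chart] only supplies a centre of projection off the
   curve. *)
have [||al [be [t [Fv _ _]]]] := @good_chart K 0 a FK (fun _ _ => 1) FK_homog FK0.
- by move=> [].
- by move=> [].
have irrF := smooth_irr Fv.
have [] := homog_prime FK_homog Fv irrF (dhomog_map iota hA) (dhomog_map iota hB).
- by exists (map_mpoly iota Q); rewrite -!rmorphM AB.
- by move/(mpoly_dvd_descent smooth_neq0); left.
- by move/(mpoly_dvd_descent smooth_neq0); right.
Qed.

Lemma curve_cancel d e A B : A \is d.-homog -> B \is e.-homog -> ~ curve_dvd F A ->
  curve_dvd F (A * B) -> curve_dvd F B.
Proof. by move=> hA hB nA /(curve_prime hA hB) []. Qed.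

Lemma curve_dvd_degree d A : A \is d.-homog -> A != 0 -> curve_dvd F A -> (a <= d)%N.
Proof.
move=> hA A0 [Q AE]; have Q0 : Q != 0 by apply: contraNneq A0 => Q0; rewrite AE Q0 mul0r.
have dA : mdeg (mlead A) = d := dhomog_mf hA (mlead_supp A0).
have dF : mdeg (mlead F) = a := dhomog_mf F_homog (mlead_supp smooth_neq0).
by rewrite -dA -dF AE mleadM ?smooth_neq0 // mdegD leq_addl.
Qed.

Lemma geval_curve_dvd A P : on_curve iota F P -> geval iota A P != 0 -> ~ curve_dvd F A.
Proof.
by move=> [_ FP] AP [Q AE]; move: AP; rewrite AE gevalM FP mulr0 eqxx.
Qed.

Lemma line_power_ndvd l m : l \is 1.-homog -> l != 0 -> ~ curve_dvd F (l ^+ m).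
Proof.
move=> hl l0; elim: m => [|m ih].
  by rewrite expr0 => /(curve_dvd_degree (dhomog1 _ _)); rewrite oner_neq0 => /(_ isT); lia.
have hlm := dhomogMn m hl.
by rewrite exprS => /(curve_prime hl hlm) [/(curve_dvd_degree hl l0)|//]; lia.
Qed.

Lemma ratexpN (t : ratfun k) e : ratexp t (- e) = ((ratexp t e).2, (ratexp t e).1).
Proof. by case: e => [[|n]|n]. Qed.

Lemma ratexp_homog t e : is_ratfun F t ->
  exists d, (ratexp t e).1 \is d.-homog /\ (ratexp t e).2 \is d.-homog.
Proof.
by move=> [d [h1 h2 _]]; case: e => n; eexists; split; apply: dhomogMn; eassumption.
Qed.

(** * Local equations of the pullback of a line *)

Section Pullback.
Variables (m : nat) (l : {mpoly k[3]}) (G : 'rV[K]_3 -> int).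
Hypotheses (l_homog : l \is 1.-homog) (l_neq0 : l != 0).
Hypothesis G_pullback : is_pullback iota F m l G.

Lemma line_power_homog : l ^+ m \is m.-homog.
Proof. by have := dhomogMn m l_homog; rewrite mul1n. Qed.

Lemma coord_power_homog i : ('X_i ^+ m : {mpoly k[3]}) \is m.-homog.
Proof.
have /(dhomogMn m) : ('X_i : {mpoly k[3]}) \is 1.-homog by rewrite dhomogX; apply/eqP/mdeg1.
by rewrite mul1n.
Qed.

Lemma form_ratfun A : A \is m.-homog -> is_ratfun F (A, l ^+ m).
Proof.
move=> hA; exists m; split=> //=; first exact: line_power_homog.
exact: line_power_ndvd.
Qed.

Lemma geval_coord i P : geval iota ('X_i ^+ m) P = P 0 i ^+ m.
Proof. by rewrite /geval rmorphXn /= map_mpolyX rmorphXn /= mevalXU. Qed.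

(** Near [P] one has [l ^+ m / 'X_i ^+ m = t ^ (G P) * u] with [u] a unit [g.1 / g.2], so
    [A / l ^+ m] is [t ^ (- G P)] times [r = A * g.2 / ('X_i ^+ m * g.1)], which is regular at
    [P]. *)
Lemma form_riemann_roch A : A \is m.-homog -> riemann_roch iota F G (A, l ^+ m).
Proof.
move=> hA; split; first exact: form_ratfun.
move=> P PX; have [i Pi] := row_coord PX.1.
have [t [u [ht [du [hu1 hu2 nu2]] [g [[dg [hg1 hg2 ng2]] [Q2 ug] g2P g1P]] [Q1 lu]]]] :=
  G_pullback PX Pi.
have [trat _ _ _] := ht; have [dt [hT1 hT2]] := ratexp_homog (G P) trat.
have XgP : geval iota ('X_i ^+ m * g.1) P != 0.
  by rewrite gevalM geval_coord mulf_neq0 // expf_neq0.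
pose r : ratfun k := (A * g.2, 'X_i ^+ m * g.1).
have rrat : is_ratfun F r.
  exists (m + dg)%N; split; [exact: dhomogM | | exact: geval_curve_dvd XgP].
  exact: dhomogM (coord_power_homog i) hg1.
exists t, r; split=> //; first by exists r; split=> //; exists 0; rewrite subrr mul0r.
rewrite ratexpN /rateq /ratmul /=; move: lu ug; rewrite /ratmul /=.
set T1 := (ratexp t (G P)).1 in hT1 *; set T2 := (ratexp t (G P)).2 in hT2 *.
move=> lu ug.
(* Passing from the representative [u] to [g] introduces the factor [u.2], which is not divisible by
   [F] and can be cancelled. *)
apply: (curve_cancel (d := du) (e := (m + (dt + (m + dg)))%N) hu2 _ nu2).
  apply: rpredB; first apply: dhomogM => //.
    by apply: dhomogM => //; apply: dhomogM hg1; exact: coord_power_homog.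
  exact: (dhomog_cast (addnC _ _) (dhomogM (dhomogM hT2 (dhomogM hA hg2)) line_power_homog)).
exists (- A * (T1 * 'X_i ^+ m * Q2 + g.2 * Q1)).
transitivity (- A * (T1 * 'X_i ^+ m * (Q2 * F) + g.2 * (Q1 * F))); last by ring.
by rewrite -lu -ug; ring.
Qed.

(** With exponent zero the local equation is a unit, so [l ^+ m * g.2] and [g.1 * 'X_i ^+ m] agree
    on the curve, and the latter does not vanish at [P]. *)
Lemma line_neq0_off_support P : on_curve iota F P -> G P = 0 -> geval iota (l ^+ m) P != 0.
Proof.
move=> PX GP; have [i Pi] := row_coord PX.1.
have [t [u [ht [du [hu1 hu2 nu2]] [g [[dg [hg1 hg2 ng2]] [Q2 ug] g2P g1P]] [Q1]]]] :=
  G_pullback PX Pi.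
rewrite GP /ratmul /= !expr0 !mul1r => lu.
have [Q QE] : curve_dvd F (l ^+ m * g.2 - g.1 * 'X_i ^+ m).
  apply: (curve_cancel (d := du) (e := (m + dg)%N) hu2 _ nu2).
    apply: rpredB; first exact: dhomogM line_power_homog hg2.
    exact: (dhomog_cast (addnC _ _) (dhomogM hg1 (coord_power_homog i))).
  exists (g.2 * Q1 + 'X_i ^+ m * Q2).
  transitivity (g.2 * (Q1 * F) + 'X_i ^+ m * (Q2 * F)); last by ring.
  by rewrite -lu -ug; ring.
apply/eqP => lP; have := congr1 (fun A => geval iota A P) QE.
rewrite /= gevalB !gevalM lP PX.2 mul0r mulr0 sub0r geval_coord => /eqP.
by rewrite oppr_eq0 mulf_eq0 (negPf g1P) expf_eq0 (negPf Pi) andbF.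
Qed.

End Pullback.
End SmoothCurve.

(** * Minimum distance *)

Lemma le_min_distance (k : finFieldType) n (C : {set 'rV[k]_n}) e :
  (forall c, c \in C -> c != 0 -> (e <= hamming_weight c)%N) ->
  le_distance e (min_distance C).
Proof.
move=> hC; rewrite /min_distance; case: pickP => [c0 c0C|] //=.
by case: arg_minnP => // c; rewrite !inE => /andP [c_neq0 cC] _; apply: hC.
Qed.

(** More points would make [p] a multiple of [f] by Bezout, but the degree of [p] in [z] is at most
    [e < a]. *)
Lemma card_zeros_curve (K : closedFieldType) (I : finType) (s z : I -> K) f p a e
    (S : {set I}) :
  injective s -> irr f -> tdeg_le a f -> size f = a.+1 ->
  (forall i, ev f (s i) (z i) = 0) ->
  p != 0 -> tdeg_le e p -> (e < a)%N -> (#|S :&: zeros s z p| <= a * e)%N.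
Proof.
move=> s_inj irrf hf sf fS p0 hp ea; rewrite leqNgt; apply/negP => lt.
have [|pt||q pE] := bezout (pts := [seq (s i, z i) | i <- enum (S :&: zeros s z p)]) irrf hf hp.
- by rewrite -map_comp map_inj_uniq ?enum_uniq.
- by case/mapP => i; rewrite mem_enum !inE => /andP [_ /eqP pi] ->; split; [exact: fS | exact: pi].
- by rewrite size_map -cardE.
have q0 : q != 0 by apply: contraNneq p0 => q0; rewrite pE q0 mul0r.
have sz : (size p <= e.+1)%N := tdeg_le_size_outer hp.
have f0 := irr_neq0 irrf.
rewrite pE size_mul // sf addnS /= in sz.
have q1 : (0 < size q)%N by rewrite size_poly_gt0.
by have := leq_trans (leq_add q1 (leqnn a)) sz; lia.
Qed.

(** * From dual codewords to relations *)

Section Code.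
Variables (k : finFieldType) (K : closedFieldType) (iota : {rmorphism k -> K}).
Variables (a m n : nat) (F : {mpoly k[3]}).
Hypotheses (a_gt1 : (1 < a)%N) (F_homog : F \is (a.-homog)).
Hypothesis X_smooth : smooth_curve iota F.
Variables (l : {mpoly k[3]}) (G : 'rV[K]_3 -> int).
Hypotheses (l_homog : l \is 1.-homog) (l_neq0 : l != 0).
Hypothesis G_pullback : is_pullback iota F m l G.
Variable P : 'I_n -> 'rV[k]_3.
Hypotheses (P_neq0 : forall i, P i != 0) (P_on_X : forall i, F.@[P i 0] = 0).
Hypothesis P_distinct : forall i j, i != j -> ~ same_point (P i) (P j).
Hypothesis P_avoid : forall i, ~ in_support iota F G (map_mx iota (P i)).

Let iota_inj : injective iota. Proof. exact: fmorph_inj. Qed.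

Lemma geval_rational A i : geval iota A (map_mx iota (P i)) = iota A.@[P i 0].
Proof. by rewrite -(meval_map _ _ iota_inj); apply: meval_eq => j; rewrite mxE. Qed.

Lemma rational_on_curve i : on_curve iota F (map_mx iota (P i)).
Proof.
split; last by rewrite geval_rational P_on_X raddf0.
by rewrite map_mx_eq0.
Qed.

Lemma line_power_neq0 i : (l ^+ m).@[P i 0] != 0.
Proof.
have PX := rational_on_curve i.
have GP : G (map_mx iota (P i)) = 0.
  by apply/eqP; apply: contrapT => /negP GP; case: (P_avoid (i := i)).
have := line_neq0_off_support a_gt1 F_homog X_smooth l_homog G_pullback PX GP.
by rewrite geval_rational; apply: contraNneq => ->; rewrite raddf0.
Qed.

Lemma dual_codeword_forms (c : 'rV[k]_n) A :
  c \in dual_code (functional_code iota F P G) -> A \is m.-homog ->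
  \sum_i c 0 i * (A.@[P i 0] / (l ^+ m).@[P i 0]) = 0.
Proof.
rewrite inE => /forall_inP hc hA.
pose x : 'rV[k]_n := \row_i (A.@[P i 0] / (l ^+ m).@[P i 0]).
have /hc /eqP : x \in functional_code iota F P G.
  rewrite inE; apply/asboolP; exists (A, l ^+ m); split.
    exact: (form_riemann_roch a_gt1 F_homog X_smooth l_homog l_neq0 G_pullback hA).
  move=> i; exists (A, l ^+ m); split; rewrite ?mxE ?line_power_neq0 //.
    exact: (form_ratfun a_gt1 F_homog X_smooth l_homog l_neq0 hA).
  by exists 0; rewrite subrr mul0r.
by move=> e; rewrite -[RHS]e; apply: eq_bigr => i _; rewrite mxE.
Qed.

Notation v := (fun i (j : 'I_3) => iota (P i 0 j)).

(** By linearity it suffices to test monomials, which are defined over [k]. *)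
Lemma dual_codeword_formsK (c : 'rV[k]_n) (A : {mpoly K[3]}) :
  c \in dual_code (functional_code iota F P G) -> A \is m.-homog ->
  \sum_i iota (c 0 i / (l ^+ m).@[P i 0]) * A.@[v i] = 0.
Proof.
move=> hc /dhomogP hA.
under eq_bigr => i _ do rewrite mevalE mulr_sumr.
rewrite exchange_big /= big_seq big1 // => mm /hA dm; have {}dm : mdeg mm = m := dm.
under eq_bigr => i _ do rewrite mulrCA.
rewrite -mulr_sumr -[RHS](mulr0 A@_mm); congr (_ * _).
have hX : ('X_[mm] : {mpoly k[3]}) \is m.-homog by rewrite dhomogX; apply/eqP.
have e := congr1 iota (dual_codeword_forms hc hX).
rewrite raddf0 rmorph_sum /= in e; rewrite -[RHS]e.
apply: eq_bigr => i _; rewrite mevalX !rmorphM rmorph_prod -mulrA; congr (_ * _).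
rewrite mulrC; congr (_ * _).
by apply: eq_bigr => j _; rewrite rmorphXn.
Qed.

Lemma dual_weight (c : 'rV[k]_n) : (3 <= a)%N ->
  c \in dual_code (functional_code iota F P G) -> c != 0 ->
  (delta a m <= hamming_weight c)%N.
Proof.
move=> a3 hc c0.
have v0 i : exists j, v i j != 0.
  have [j Pj] : exists j, P i 0 j != 0 by apply: row_coord; apply: P_neq0.
  by exists j; rewrite fmorph_eq0.
have vij i j : i != j -> ~ exists x, x != 0 /\ forall r, v i r = x * v j r.
  move=> /P_distinct nsame [x [x0 vx]]; apply: nsame; have [r vr] := v0 j.
  (* Proportionality over [K] descends to [k]: the factor is a quotient of coordinates in [k]. *)
  exists (P i 0 r / P j 0 r).
  have Pr : P j 0 r != 0 by apply: contraNneq vr => ->; rewrite raddf0.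
  have xE : x = iota (P i 0 r / P j 0 r) by rewrite fmorph_div vx mulfK.
  split; first by apply: contraNneq x0; rewrite xE => ->; rewrite raddf0.
  by apply/rowP => q; rewrite mxE; apply: iota_inj; rewrite rmorphM -xE.
pose FK := map_mpoly iota F.
have FK_homog : FK \is (a.-homog) by apply: dhomog_map.
have FK0 : FK != 0 by rewrite map_mpoly_eq0 (smooth_neq0 X_smooth).
have [al [be [t [Fv x0 s_inj]]]] := good_chart FK_homog FK0 v0 vij.
pose x i := (form0 al be t).@[v i]; pose y i := (form1 be).@[v i].
pose s i := y i / x i; pose z i := v i o2 / x i.
have irrf := smooth_irr a_gt1 F_homog X_smooth Fv.
have fP i : ev (dehomog al be t FK) (s i) (z i) = 0.
  have := meval_chart al be t (y i) (v i o2) FK_homog (x0 i).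
  rewrite (meval_eq _ (pointK al be t (v i))) /FK meval_map // P_on_X raddf0.
  by move/esym/eqP; rewrite mulf_eq0 expf_eq0 (negPf (x0 i)) andbF => /eqP.
have few p e (S : {set 'I_n}) : p != 0 -> tdeg_le e p -> (e < a)%N ->
    (#|S :&: zeros s z p| <= a * e)%N.
  apply: card_zeros_curve s_inj irrf (tdeg_dehomog _ _ _ FK_homog) _ fP.
  exact: size_dehomog FK_homog Fv.
(* The factor [x i ^+ m] compensates for dehomogenization; all rescalings are nonzero, so the
   support is that of [c]. *)
pose w i := iota (c 0 i / (l ^+ m).@[P i 0]) * x i ^+ m.
have rw : relation s z m w.
  move=> p hp; rewrite -[RHS](dual_codeword_formsK hc (homogenize_homog al be t hp)).
  apply: eq_bigr => i _; rewrite -(meval_eq _ (pointK al be t (v i))).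
  by rewrite (homogenize_affine _ _ _ _ _ hp (x0 i)) /w mulrA.
have sw : supp w = [set i | c 0 i != 0].
  apply/setP => i; rewrite !inE /w mulf_eq0 negb_or fmorph_eq0 mulf_eq0 negb_or.
  by rewrite invr_eq0 line_power_neq0 expf_neq0 ?x0 // !andbT.
have sw0 : supp w != set0.
  apply: contraNneq c0 => e; apply/eqP/rowP => i; rewrite mxE; apply/eqP.
  by apply: contraT => ci; have := in_set0 i; rewrite -e sw inE ci.
rewrite /hamming_weight -sw leqNgt; apply/negP; rewrite /delta.
have W := relation_weight s_inj rw sw0.
case: (leqP m (a - 2)) => [_|m1]; first by lia.
case: (m =P (a - 1)%N) => [mE|mE] lt.
  (* Here [m + 2 = a + 1] points on a line exceed the Bezout bound [a]. *)
  have [|p [p0 hp cp]] := relation_line s_inj rw sw0; first by lia.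
  by move: (leq_trans cp (few p 1%N _ p0 hp a_gt1)) m1; clear; lia.
(* Now [m >= a], so [m + 2 > a] rules out the line and [2 * m + 2 > 2 * a] the conic. *)
have [[p [p0 hp cp]]|[p [p0 hp cp]]] := relation_line_or_conic s_inj rw sw0 lt.
  by move: (leq_trans cp (few p 1%N _ p0 hp a_gt1)) m1; clear; lia.
by move: (leq_trans cp (few p 2%N _ p0 hp a3)) m1 mE; clear; lia.
Qed.

End Code.

Theorem theorem4p1 (k : finFieldType) (kbar : closedFieldType)
    (iota : {rmorphism k -> kbar}) (kbar_alg : integralRange iota)
    (a m n : nat) (a_ge3 : (3 <= a)%N)
    (F : {mpoly k[3]}) (F_homog : F \is (a.-homog))
    (X_smooth : smooth_curve iota F)
    (l : {mpoly k[3]}) (l_homog : l \is 1.-homog) (l_neq0 : l != 0)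
    (G : 'rV[kbar]_3 -> int) (G_pullback : is_pullback iota F m l G)
    (P : 'I_n -> 'rV[k]_3)
    (P_neq0 : forall i, P i != 0)
    (P_on_X : forall i, F.@[P i 0] = 0)
    (P_distinct : forall i j, i != j -> ~ same_point (P i) (P j))
    (P_avoid : forall i, ~ in_support iota F G (map_mx iota (P i))) :
  [/\ (delta_G a m < (delta a m)%:Z <-> delta_G a m <= 0),
      (delta_G a m <= 0 <-> (m <= a - 3)%N) &
      le_distance (delta a m)
        (min_distance (dual_code (functional_code iota F P G)))].
Proof.
have dG : delta_G a m <= 0 <-> (m <= a - 3)%N.
  by rewrite /delta_G; split=> h; nia.
split=> //.
(* The bounds coincide for [m = a - 2] and [m = a - 1]; for [m >= a] the difference
   [delta_G - delta] is [(a - 3) * (m - a)], which is nonnegative. *)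
- rewrite dG /delta_G /delta; case: (leqP m (a - 2)) => h1; first by split=> h; nia.
  by case: (m =P (a - 1)%N) => h2; split=> h; nia.
- apply: le_min_distance => c hc c0.
  exact: (dual_weight (ltnW a_ge3) F_homog X_smooth l_homog l_neq0 G_pullback P_neq0 P_on_X
    P_distinct P_avoid a_ge3 hc c0).
Qed.
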